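(* Let $\mathbb{P}$ be the set of all prime numbers. For all integers $b\ge2$ and $k\ge0$, $$\alpha_k(\mathbb{P},b)=\max\left\{0,\ \left\lfloor\frac{k-\omega(b)}{\varphi(b)}\right\rfloor+\left\lfloor\frac{k-\omega(b)}{b\varphi(b)}\right\rfloor+\left\lfloor\frac{k-\omega(b)}{b^2\varphi(b)}\right\rfloor+\cdots\right\},$$ where $\varphi$ is Euler's totient function and $\omega(b)$ is the number of distinct prime divisors of $b$. In particular, $\alpha_k(\mathbb{P},b)=0$ if $\varphi(b)+\omega(b)>k$.
   Context: For $b\ge2$ and $a\in\mathbb{Z}$, $\operatorname{ord}_b(a)$ is the largest $k\in\mathbb{N}$ with $b^k\mid a$ ($+\infty$ for $a=0$). For nonempty $S\subseteq\mathbb{Z}$, a $b$-ordering of $S$ is a sequence $(a_i)_{i\ge0}$ in $S$ such that for each $i\ge1$, $a_i$ attains $\min_{a'\in S}\sum_{j=0}^{i-1}\operatorname{ord}_b(a'-a_j)$; the $b$-exponent sequence of $S$ is $\alpha_k(S,b):=\sum_{j=0}^{k-1}\operatorname{ord}_b(a_k-a_j)$ for any $b$-ordering (independent of the choice). *)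

(* Defs.v *)
From mathcomp Require Import all_boot all_order all_algebra.
Set Implicit Arguments. Unset Strict Implicit. Unset Printing Implicit Defensive.
Import Order.TTheory GRing.Theory Num.Theory.

(* Extended naturals N u {+oo}: [Some n] is n, [None] is +oo. *)
Definition enat := option nat.
Definition eadd (x y : enat) : enat :=
  match x, y with Some m, Some n => Some (m + n) | _, _ => None end.
Definition ele (x y : enat) : bool :=
  match x, y with
  | _, None => true
  | None, Some _ => false
  | Some m, Some n => m <= n
  end.

(* ord_b(a): the largest k with b^k | a, and +oo for a = 0.
   For b >= 2 and a <> 0, any k with b^k | a satisfies k < |a|+1,
   so the max over k < |a|+1 is the largest such k. *)
Definition ordb (b : nat) (a : int) : enat :=
  if a == 0%R then None
  else Some (\max_(k < (absz a).+1 | b ^ k %| absz a) k).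

Definition psum (b : nat) (a : nat -> int) (x : int) (i : nat) : enat :=
  foldr (fun j acc => eadd (ordb b (x - a j)%R) acc) (Some 0) (iota 0 i).

Definition is_b_ordering (S : pred int) (b : nat) (a : nat -> int) : Prop :=
  (forall i, S (a i)) /\
  (forall i, 1 <= i -> forall a', S a' -> ele (psum b a (a i) i) (psum b a a' i)).

Definition alpha_of (b : nat) (a : nat -> int) (k : nat) : enat := psum b a (a k) k.

Definition primesZ : pred int := fun z => (0 < z)%R && prime (absz z).

Definition omega (b : nat) : nat := size (primes b).

(* max{0, sum_{i>=0} floor((k - omega b) / (b^i phi(b)))}.
   If k < omega b every term is <= -1, the series diverges to -oo, max is 0.
   Otherwise all terms are nonnegative integer quotients, and those with
   i > k vanish (b^i > k), so the sum over i <= k is the full series. *)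
Definition rhs (b k : nat) : nat :=
  if omega b <= k then \sum_(i < k.+1) ((k - omega b) %/ (b ^ i * totient b))
  else 0.

(* Main.v *)
Require Import Defs.
From mathcomp Require Import all_boot all_order all_algebra.
From mathcomp Require Import all_fingroup all_solvable all_field all_character.
From mathcomp Require Import complex lra ring zify Rstruct.
From Stdlib Require Import Classical ClassicalEpsilon.
From Stdlib Require Rdefinitions Rpower Rtrigo_def Exp_prop.
Set Implicit Arguments. Unset Strict Implicit. Unset Printing Implicit Defensive.
Import Order.TTheory GRing.Theory Num.Theory Normc.

(** Let [omega] and [phi] refer to the modulus [b]. A prime dividing [b] is
congruent to no other prime modulo [b], and the remaining primes are units, so
the values of the ordering count coincidences between primes modulo the powers
[b^l].  Given any [k] primes, either some prime divisor of [b] is unused, and it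
costs nothing, or at most [k - omega] of them are units; then, descending
through the residue classes modulo [b, b^2, ...] and always choosing the
lightest one, one meets a class at level [l] holding at most
[(k - omega) / (b^(l-1) phi)] of the points, and Dirichlet's theorem provides a
prime in it.  Hence each term of the exponent sequence is at most the formula.
Conversely, by convexity, any [n] distinct primes have at least as many
coincidences modulo [b^l] as a perfectly balanced configuration, which bounds
the sum of the first [n] terms from below by the sum of the formula.  Both
together force equality term by term.

Dirichlet's theorem is in fact equivalent to the statement, and it is proved by
Mertens-style estimates on finite sums only.  For a nonprincipal character
[chi], [L(x) = sum_(n <= x) chi n / n] either satisfies [L(x) = O(1/x)],
in which case [chi] is called vanishing, or is bounded away from 0 for large [x].  Moebius inversion gives
[sum_(n <= x) chi n Lambda n / n = O(1)] in the second case and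
[- log x + O(1)] in the first.  A non-real vanishing character vanishes together
with its conjugate, so that summing over all characters would make
[sum_(n = 1 mod N) Lambda n / n] tend to [- oo].  For a real [chi], the
coefficients [r = 1 * chi] are nonnegative and at least 1 on squares, so
[sum_(n <= X) r n (X - n)] has order at least [X^(3/2)], which contradicts
[L(x) = O(1/x)] by the hyperbola method.  Orthogonality of characters
concludes. *)

Local Open Scope ring_scope.

(** * Divisor sums and the Moebius function *)

(** Stripping the full power of the least prime factor leaves a smaller coprime cofactor; every
    multiplicative identity below is proved along this induction. *)
Lemma prime_power_ind (P : nat -> Prop) :
  P 1%N ->
  (forall p k m, prime p -> (0 < m)%N -> coprime p m -> P m ->
     P (p ^ k.+1 * m)%N) ->
  forall n, (0 < n)%N -> P n.
Proof.
move=> P1 Pp; elim/ltn_ind=> n IH n_gt0.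
have [n_le1|n_gt1] := leqP n 1.
  by have -> : n = 1%N by apply/eqP; rewrite eqn_leq n_le1 n_gt0.
have p_pr := pdiv_prime n_gt1.
have [m cpm Dn] := pfactor_coprime p_pr n_gt0.
have k_gt0 : (0 < logn (pdiv n) n)%N by rewrite logn_gt0 mem_primes p_pr n_gt0 pdiv_dvd.
have m_gt0 : (0 < m)%N by move: n_gt0; rewrite Dn muln_gt0 => /andP[].
rewrite Dn mulnC -(prednK k_gt0); apply: Pp => //; apply: IH => //.
rewrite Dn -{1}(muln1 m) ltn_pmul2l // -(exp1n (logn (pdiv n) n)).
by rewrite ltn_exp2r ?prime_gt1.
Qed.

Lemma divisors_prime_power (p k m : nat) : prime p -> (0 < m)%N -> coprime p m ->
  perm_eq (divisors (p ^ k * m)) [seq p ^ i * d | i <- iota 0 k.+1, d <- divisors m]%N.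
Proof.
move=> p_pr m_gt0 cpm; have p_gt0 := prime_gt0 p_pr.
have pk_gt0 i : (0 < p ^ i)%N by rewrite expn_gt0 p_gt0.
have div_gt0 d : (d \in divisors m)%N -> (0 < d)%N.
  by rewrite -dvdn_divisors // => /dvdn_gt0; apply.
have cpd d : (d \in divisors m)%N -> coprime p d.
  by rewrite -dvdn_divisors // => dm; apply: coprime_dvdr dm cpm.
apply: uniq_perm; first exact: divisors_uniq.
  apply: allpairs_uniq; rewrite ?iota_uniq ?divisors_uniq //.
  move=> [i d] [j e] /allpairsPdep[i1 [d1 [_ D1 [-> ->]]]] /allpairsPdep[j1 [e1 [_ E1 [-> ->]]]] /= E.
  have lD x y : (y \in divisors m)%N -> logn p (p ^ x * y)%N = x.
    move=> yD; rewrite lognM ?pk_gt0 ?div_gt0 // pfactorK // logn_coprime ?addn0 //.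
    exact: cpd.
  have Eij : i1 = j1 by rewrite -(lD i1 d1) // -(lD j1 e1) // E.
  by move: E; rewrite Eij => /eqP; rewrite eqn_pmul2l // => /eqP ->.
move=> d; rewrite -dvdn_divisors ?muln_gt0 ?pk_gt0 //.
apply/idP/allpairsPdep => [dvd|[i [e [+ + ->]]]]; last first.
  rewrite mem_iota /= add0n ltnS -dvdn_divisors // => ik em.
  by rewrite dvdn_mul // dvdn_exp2l.
have d_gt0 : (0 < d)%N by apply: dvdn_gt0 dvd; rewrite muln_gt0 pk_gt0.
have [e cpe De] := pfactor_coprime p_pr d_gt0.
exists (logn p d), e; split; last by rewrite mulnC.
  rewrite mem_iota /= add0n ltnS -(pfactorK k p_pr).
  have : (p ^ logn p d %| p ^ k * m)%N by apply: dvdn_trans dvd; rewrite [X in (_ %| X)%N]De dvdn_mull.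
  rewrite Gauss_dvdl ?coprimeXl // => dv; rewrite pfactorK //.
  by rewrite -(dvdn_Pexp2l _ _ (prime_gt1 p_pr)).
rewrite -dvdn_divisors //.
have : (e %| p ^ k * m)%N by apply: dvdn_trans dvd; rewrite [X in (_ %| X)%N]De dvdn_mulr.
by rewrite Gauss_dvdr // coprime_sym coprimeXl.
Qed.

Lemma sum_divisors_prime_power (V : nmodType) (F : nat -> V) (p k m : nat) :
  prime p -> (0 < m)%N -> coprime p m ->
  \sum_(d <- divisors (p ^ k * m)) F d
  = \sum_(0 <= i < k.+1) \sum_(d <- divisors m) F (p ^ i * d)%N.
Proof.
move=> p_pr m_gt0 cpm.
by rewrite (perm_big _ (divisors_prime_power k p_pr m_gt0 cpm)) big_allpairs_dep.
Qed.

Lemma divisors_gt0 d n : d \in divisors n -> (0 < d)%N.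
Proof.
case: n => [|n]; first by rewrite inE => /eqP ->.
by rewrite -dvdn_divisors // => /dvdn_gt0; apply.
Qed.

Definition mobius (n : nat) : int :=
  \prod_(p <- primes n) (if logn p n == 1%N then -1 else 0).

Lemma mobius1 : mobius 1 = 1.
Proof. by rewrite /mobius big_nil. Qed.

Lemma norm_mobius n : `|mobius n| <= 1.
Proof.
rewrite /mobius; elim/big_rec: _ => [|p x _ x1]; first by rewrite normr1.
rewrite normrM mulr_ile1 //.
by case: ifP.
Qed.

Lemma mobius_prime_power (p k m : nat) : prime p -> (0 < m)%N -> coprime p m ->
  mobius (p ^ k.+1 * m) = if k == 0%N then - mobius m else 0.
Proof.
move=> p_pr m_gt0 cpm; have p_gt0 := prime_gt0 p_pr.
have pk_gt0 i : (0 < p ^ i)%N by rewrite expn_gt0 p_gt0.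
have pNm : p \notin primes m.
  by rewrite mem_primes p_pr m_gt0 /= -prime_coprime.
have perm : perm_eq (primes (p ^ k.+1 * m)) (p :: primes m).
  apply: uniq_perm; rewrite ?primes_uniq //= ?pNm ?primes_uniq // => q.
  by rewrite primesM // primesX // primes_prime // !inE.
rewrite /mobius (perm_big _ perm) /= big_cons lognM // pfactorK // logn_coprime // addn0.
rewrite eqSS; case: (k =P 0)%N => [->|_]; last by rewrite mul0r.
rewrite mulN1r; congr (- _); apply: eq_big_seq => q qm.
rewrite lognM // expn1 logn_prime //.
by case: (q =P p) qm => [->|//]; rewrite (negbTE pNm).
Qed.

(** Among the exponents of [p], only 0 and 1 give nonzero terms, and these cancel. *)
Lemma sum_mobius n : (0 < n)%N -> \sum_(d <- divisors n) mobius d = (n == 1%N)%:R.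
Proof.
move: n; apply: prime_power_ind => [|p k m p_pr m_gt0 cpm _].
  by rewrite big_seq1 mobius1.
rewrite sum_divisors_prime_power // big_nat_recl // expn0.
rewrite (eq_bigr mobius) => [|d _]; last by rewrite mul1n.
have cpd d : d \in divisors m -> coprime p d.
  by rewrite -dvdn_divisors // => dm; apply: coprime_dvdr dm cpm.
rewrite big_nat_recl // [X in _ + (X + _)](_ : _ = - \sum_(d <- divisors m) mobius d); last first.
  rewrite -sumrN; apply: eq_big_seq => d dm.
  by rewrite mobius_prime_power ?cpd ?(divisors_gt0 dm).
rewrite [X in _ + (_ + X)]big1_seq => [|i _]; last first.
  by rewrite big1_seq // => d /andP[_ dm]; rewrite mobius_prime_power ?cpd ?(divisors_gt0 dm).
rewrite addr0 subrr; case: eqP => // /eqP.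
have p1 := prime_gt1 p_pr.
by rewrite muln_eq1 -(expn0 p) eqn_exp2l.
Qed.

Lemma sum_divisors_index (V : nmodType) (F : nat -> V) (n x : nat) :
  (0 < n <= x)%N ->
  \sum_(d <- divisors n) F d = \sum_(1 <= d < x.+1 | (d %| n)%N) F d.
Proof.
move=> /andP[n_gt0 nx]; rewrite -[RHS]big_filter; apply: perm_big.
apply: uniq_perm; rewrite ?divisors_uniq ?filter_uniq ?iota_uniq // => d.
rewrite mem_filter mem_index_iota -dvdn_divisors //.
case dn: (d %| n)%N => //=.
by rewrite (dvdn_gt0 n_gt0 dn) ltnS (leq_trans (dvdn_leq n_gt0 dn)).
Qed.

Lemma sum_multiples (V : nmodType) (F : nat -> V) (d x : nat) : (0 < d)%N ->
  \sum_(1 <= n < x.+1 | (d %| n)%N) F n = \sum_(1 <= m < (x %/ d).+1) F (d * m)%N.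
Proof.
move=> d_gt0; rewrite -[LHS]big_filter -(big_map (muln d) xpredT F); apply: perm_big.
apply: uniq_perm; rewrite ?filter_uniq ?iota_uniq //.
  rewrite map_inj_uniq ?iota_uniq // => a b /eqP; rewrite eqn_pmul2l //.
  by move/eqP.
move=> n; rewrite mem_filter mem_index_iota.
apply/idP/mapP => [/andP[/dvdnP[m ->] /andP[m0 mx]]|[m + ->]].
  exists m; last by rewrite mulnC.
  rewrite mem_index_iota ltnS leq_divRL //; rewrite ltnS in mx; rewrite mx andbT.
  by move: m0; rewrite muln_gt0 => /andP[].
rewrite mem_index_iota !ltnS leq_divRL // dvdn_mulr //= muln_gt0 d_gt0 => /andP[-> /=].
by rewrite mulnC.
Qed.

(** Both sides run over the pairs [(d, m)] with [d * m <= x], grouped by product on the left and by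
    first factor on the right. *)
Lemma sum_divisors_exchange (V : nmodType) (F : nat -> nat -> V) (x : nat) :
  \sum_(1 <= n < x.+1) \sum_(d <- divisors n) F d (n %/ d)%N
  = \sum_(1 <= d < x.+1) \sum_(1 <= m < (x %/ d).+1) F d m.
Proof.
rewrite (eq_big_nat _ _ (F2 := fun n => \sum_(1 <= d < x.+1 | (d %| n)%N) F d (n %/ d)%N)).
  rewrite (exchange_big_dep_nat xpredT) //=; apply: eq_big_nat => d /andP[d_gt0 _].
  rewrite sum_multiples //; apply: eq_bigr => m _.
  by rewrite mulKn.
by move=> n nx; rewrite (@sum_divisors_index _ _ _ x).
Qed.

(** * Logarithms and the von Mangoldt function *)

(** The few properties of the natural logarithm that the estimates use, so that these stay
    algebraic; [log_incr] is [ln t <= t - 1] at [t = m / n], together with monotonicity. *)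
Record logarithm (R : realFieldType) := Logarithm {
  log_fun :> nat -> R;
  logM : forall m n, (0 < m)%N -> (0 < n)%N ->
    log_fun (m * n)%N = log_fun m + log_fun n;
  log_incr : forall m n, (0 < n <= m)%N ->
    0 <= log_fun m - log_fun n <= (m%:R - n%:R) / n%:R;
  log_unbounded : forall K, exists2 n, (0 < n)%N & K < log_fun n }.

Section Logarithm.
Variables (R : realFieldType) (ell : logarithm R).

Lemma log1 : ell 1 = 0.
Proof. by have := logM ell (ltnSn 0) (ltnSn 0); rewrite mul1n; lra. Qed.

Lemma le_log m n : (0 < n <= m)%N -> ell n <= ell m.
Proof. by move/(log_incr ell) => /andP[]; lra. Qed.

Lemma log_ge0 n : (0 < n)%N -> 0 <= ell n.
Proof. by move=> n0; rewrite -log1; apply: le_log. Qed.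

Lemma log_divn n d : (0 < n)%N -> (d %| n)%N -> ell (n %/ d)%N = ell n - ell d.
Proof.
move=> n_gt0 dn; have d_gt0 := dvdn_gt0 n_gt0 dn.
rewrite -{2}(divnK dn) logM ?addrK //.
by rewrite divn_gt0 // dvdn_leq.
Qed.

(** Equal to the usual sum of [mobius d * log (n / d)], since the part in [log n] cancels; see
    [sum_mobius_log]. *)
Definition mangoldt (n : nat) : R :=
  - \sum_(d <- divisors n) (mobius d)%:~R * ell d.

Lemma mangoldt1 : mangoldt 1 = 0.
Proof. by rewrite /mangoldt big_seq1 log1 mulr0 oppr0. Qed.

Lemma sum_mobius_intr n : (0 < n)%N ->
  \sum_(d <- divisors n) (mobius d)%:~R = (n == 1%N)%:R :> R.
Proof. by move=> n0; rewrite -rmorph_sum /= sum_mobius //; case: eqP. Qed.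

(** The logarithms for the exponents 0 and 1 of [p] differ by [ell p], which leaves [ell p] times
    the Moebius sum over the divisors of [m]. *)
Lemma mangoldt_prime_power (p k m : nat) : prime p -> (0 < m)%N -> coprime p m ->
  mangoldt (p ^ k.+1 * m) = if m == 1%N then ell p else 0.
Proof.
move=> p_pr m_gt0 cpm; rewrite /mangoldt.
rewrite sum_divisors_prime_power // big_nat_recl // expn0.
rewrite (eq_bigr (fun d => (mobius d)%:~R * ell d)) => [|d _]; last by rewrite mul1n.
have cpd d : d \in divisors m -> coprime p d.
  by rewrite -dvdn_divisors // => dm; apply: coprime_dvdr dm cpm.
rewrite big_nat_recl // [X in _ + (_ + X)]big1_seq => [|i _]; last first.
  rewrite big1_seq // => d /andP[_ dm].
  by rewrite mobius_prime_power ?cpd ?(divisors_gt0 dm) //= mul0r.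
rewrite addr0 [X in _ + X](_ : _ = - \sum_(d <- divisors m) (mobius d)%:~R * ell d
   - ell p * \sum_(d <- divisors m) (mobius d)%:~R); last first.
  rewrite mulr_sumr -!sumrN -big_split /=; apply: eq_big_seq => d dm.
  rewrite mobius_prime_power ?cpd ?(divisors_gt0 dm) // eqxx expn1.
  rewrite logM ?(prime_gt0 p_pr) ?(divisors_gt0 dm) // intrN; ring.
rewrite sum_mobius_intr //.
by case: eqP => _ /=; ring.
Qed.

Lemma mangoldt_ge0 n : 0 <= mangoldt n.
Proof.
case: n => [|n]; first by rewrite /mangoldt big_seq1 /mobius big_nil mul1r log1 oppr0.
have: (0 < n.+1)%N by [].
move: n.+1; apply: prime_power_ind => [|p k m p_pr m0 cpm _]; first by rewrite mangoldt1.
by rewrite mangoldt_prime_power //; case: ifP; rewrite ?log_ge0 ?prime_gt0.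
Qed.

Lemma sum_mangoldt n : (0 < n)%N -> \sum_(d <- divisors n) mangoldt d = ell n.
Proof.
move: n; apply: prime_power_ind => [|p k m p_pr m0 cpm IH].
  by rewrite big_seq1 mangoldt1 log1.
have cpd d : d \in divisors m -> coprime p d.
  by rewrite -dvdn_divisors // => dm; apply: coprime_dvdr dm cpm.
rewrite sum_divisors_prime_power // big_nat_recl // expn0.
rewrite (eq_bigr mangoldt) => [|d _]; last by rewrite mul1n.
rewrite IH (eq_bigr (fun=> ell p)) => [|i _]; last first.
  rewrite (eq_big_seq (fun d => if d == 1%N then ell p else 0)) => [|d dm].
    rewrite -big_mkcond /= -big_filter (_ : [seq i <- _ | _] = [:: 1%N]) ?big_seq1 //.
    have := filter_pred1_uniq (divisors_uniq m) (_ : 1%N \in divisors m).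
    by apply; rewrite -dvdn_divisors.
  by rewrite mangoldt_prime_power ?cpd ?(divisors_gt0 dm).
rewrite sumr_const_nat subn0 logM ?expn_gt0 ?(prime_gt0 p_pr) // addrC; congr (_ + _).
elim: k {IH} => [|k IH]; first by rewrite expn1.
by rewrite expnS logM ?expn_gt0 ?(prime_gt0 p_pr) // -IH mulrS.
Qed.

Lemma sum_mobius_log n : (0 < n)%N ->
  \sum_(d <- divisors n) (mobius d)%:~R * ell (n %/ d)%N = mangoldt n.
Proof.
move=> n0; rewrite (eq_big_seq (fun d => (mobius d)%:~R * ell n - (mobius d)%:~R * ell d)).
  rewrite sumrB -mulr_suml sum_mobius_intr // /mangoldt.
  by case: eqP => [->|_]; rewrite ?log1 /= ?mulr0n ?mul0r ?mulr0 sub0r.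
by move=> d; rewrite -dvdn_divisors // => dn; rewrite log_divn //; ring.
Qed.

(** This is [log x! >= x log x - x]: passing from [x] to [x + 1] adds [x] times an increment of at
    most [1 / x]. *)
Lemma sum_log_diff x : \sum_(1 <= d < x.+1) (ell x - ell d) <= x%:R.
Proof.
elim: x => [|x IH]; first by rewrite big_nil.
rewrite big_nat_recr //= subrr addr0.
have [->|x_gt0] := posnP x; first by rewrite big_nil.
rewrite (eq_bigr (fun d => (ell x.+1 - ell x) + (ell x - ell d))) => [|d _]; last by ring.
rewrite big_split /= sumr_const_nat subn1 /= -mulr_natr.
have /(log_incr ell)/andP[_] : (0 < x <= x.+1)%N by rewrite x_gt0 /=.
rewrite -natr1 [x%:R + 1]addrC addrK mul1r => h.
have x0 : (0 : R) < x%:R by rewrite ltr0n.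
have : (ell x.+1 - ell x) * x%:R <= x%:R^-1 * x%:R by rewrite ler_pM2r.
rewrite mulVf ?gt_eqF //; lra.
Qed.

(** Legendre's formula for the logarithm of [x!]. *)
Lemma sum_log_mangoldt x :
  \sum_(1 <= n < x.+1) ell n = \sum_(1 <= d < x.+1) mangoldt d * (x %/ d)%N%:R.
Proof.
rewrite (eq_big_nat _ _ (F2 := fun n => \sum_(d <- divisors n) mangoldt d)).
  rewrite (sum_divisors_exchange (fun d _ => mangoldt d)).
  apply: eq_bigr => d _.
  by rewrite sumr_const_nat subn1 mulr_natr.
by move=> n /andP[n0 _]; rewrite sum_mangoldt.
Qed.

Lemma mertens_lower x : (0 < x)%N ->
  ell x - 1 <= \sum_(1 <= d < x.+1) mangoldt d / d%:R.
Proof.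
move=> x_gt0; have x0 : (0 : R) < x%:R by rewrite ltr0n.
rewrite -(ler_pM2r x0) mulr_suml.
apply: (@le_trans _ _ (\sum_(1 <= n < x.+1) ell n)).
  have := sum_log_diff x; rewrite sumrB sumr_const_nat subn1 /= -mulr_natr.
  lra.
rewrite sum_log_mangoldt; apply: ler_sum_nat => d /andP[d0 _].
rewrite -mulrA ler_wpM2l ?mangoldt_ge0 //.
rewrite mulrC ler_pdivlMr ?ltr0n // -natrM ler_nat.
exact: leq_divM.
Qed.

(* Restricting [sum_log_mangoldt] at [2y] to [d <= y] makes the quotients [2y %/ d] at least 2, so that flooring loses a factor at most 3/2 and no Chebyshev bound is needed. *)
Lemma mertens_upper y : (0 < y)%N ->
  \sum_(1 <= d < y.+1) mangoldt d / d%:R <= 3 / 2 * ell (2 * y)%N.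
Proof.
move=> y_gt0; have y0 : (0 : R) < y%:R by rewrite ltr0n.
suff h : \sum_(1 <= d < y.+1) mangoldt d / d%:R * (4 / 3 * y%:R) <= ell (2 * y)%N * (2 * y%:R).
  rewrite -mulr_suml in h.
  rewrite -(@ler_pM2r _ (4 / 3 * y%:R)); last by lra.
  by apply: le_trans h _; rewrite le_eqVlt; apply/orP; left; apply/eqP; field.
apply: (@le_trans _ _ (\sum_(1 <= n < (2 * y).+1) ell n)); last first.
  apply: (@le_trans _ _ (\sum_(1 <= n < (2 * y).+1) ell (2 * y)%N)).
    by apply: ler_sum_nat => n /andP[n0 n1]; rewrite le_log // n0 -ltnS.
  by rewrite sumr_const_nat subSS subn0 -[X in X <= _]mulr_natr natrM.
rewrite sum_log_mangoldt [X in _ <= X](@big_cat_nat _ _ _ y.+1) //=; last by lia.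
rewrite -[X in X <= _]addr0; apply: lerD; last first.
  by apply: sumr_ge0 => d _; rewrite mulr_ge0 ?mangoldt_ge0.
apply: ler_sum_nat => d /andP[d0 dy].
rewrite -mulrA ler_wpM2l ?mangoldt_ge0 // mulrC ler_pdivrMr ?ltr0n //.
have : (4 * y <= 3 * ((2 * y) %/ d * d))%N.
  have q2 : (2 <= (2 * y) %/ d)%N by rewrite leq_divRL //; lia.
  have := ltn_ceil (2 * y) d0; nia.
rewrite -(ler_nat R) !natrM; lra.
Qed.

Lemma mangoldt_neq0 n : (0 < n)%N -> mangoldt n != 0 ->
  exists p k, [/\ prime p, n = (p ^ k.+1)%N & mangoldt n = ell p].
Proof.
move: n; apply: prime_power_ind => [|p k m p_pr m0 cpm _]; first by rewrite mangoldt1 eqxx.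
rewrite mangoldt_prime_power //; case: (m =P 1%N) => [->|_]; last by rewrite eqxx.
by exists p, k; rewrite muln1.
Qed.

Lemma sum_geometric_tail (p m : nat) : (1 < p)%N ->
  \sum_(2 <= k < m) (p ^ k)%:R^-1 <= (p%:R * (p%:R - 1))^-1 :> R.
Proof.
move=> p1; have p0 : (1 : R) < p%:R by rewrite ltr1n.
case: m => [|[|m]]; try by rewrite big_geq // invr_ge0 mulr_ge0 //; lra.
(* Closed form of the partial geometric sum; the subtracted remainder is nonnegative. *)
suff -> : \sum_(2 <= k < m.+2) (p ^ k)%:R^-1
   = (p%:R * (p%:R - 1))^-1 - ((p ^ m.+1)%:R * (p%:R - 1))^-1 :> R.
  by rewrite gerBl invr_ge0 mulr_ge0 //; lra.
elim: m => [|m IH]; first by rewrite big_geq // expn1 subrr.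
rewrite big_nat_recr //= IH !expnS !natrM natrX; field.
by rewrite !(gt_eqF, expf_neq0) //=; lra.
Qed.

Lemma sum_log_telescope x :
  \sum_(2 <= n < x) ell n / (n%:R * (n%:R - 1)) <= 2.
Proof.
case: x => [|[|x]]; try by rewrite big_geq.
(* The remainder imitates the tail integral of [log t / t ^ 2], which is [(log t + 1) / t]; the
   constant 2 makes the case [x = 0] an equality and absorbs the discretization. *)
suff : \sum_(2 <= n < x.+2) ell n / (n%:R * (n%:R - 1)) <= 2 - (ell x.+1 + 2) / x.+1%:R.
  have : 0 <= (ell x.+1 + 2) / x.+1%:R.
    by rewrite divr_ge0 ?ler0n // addr_ge0 ?log_ge0.
  by move: (_ / x.+1%:R) => t; move: (\sum_(_ <= _ < _) _) => S; lra.
elim: x => [|x IH]; first by rewrite big_geq // log1; lra.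
rewrite big_nat_recr //=; set S := \sum_(_ <= _ < _) _ in IH *.
have /(log_incr ell)/andP[] : (0 < x.+1 <= x.+2)%N by lia.
set a := ell x.+1 in IH *; set b := ell x.+2.
rewrite -[x.+2%:R]natr1; have : (1 : R) <= x.+1%:R by rewrite ler1n.
move: IH; move: (x.+1%:R : R) => t IH t1 h0 h.
have h1 : (b - a) * t <= 1.
  move: h; rewrite ler_pdivlMr; last lra.
  lra.
have e : (t + 1 - 1) = t by ring.
suff : b / ((t + 1) * t) <= (a + 2) / t - (b + 2) / (t + 1) by rewrite e; lra.
have -> : (a + 2) / t - (b + 2) / (t + 1) = ((a + 2) * (t + 1) - (b + 2) * t) / ((t + 1) * t).
  by field; apply/andP; split; rewrite gt_eqF //; lra.
rewrite ler_wpM2r ?invr_ge0 ?mulr_ge0 //; try lra.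
have h2 : (b - a) <= (b - a) * t by rewrite -{1}(mulr1 (b - a)) ler_wpM2l //; lra.
have -> : (a + 2) * (t + 1) - (b + 2) * t = a + 2 - (b - a) * t by ring.
lra.
Qed.

(** Only powers [p ^ k] with [k >= 2] contribute. Summing the geometric tails, and letting [p] run
    over all integers from 2 on, gives the series of [sum_log_telescope]. *)
Lemma sum_mangoldt_nonprime x :
  \sum_(1 <= n < x.+1 | ~~ prime n) mangoldt n / n%:R <= 2.
Proof.
pose t p k n : R := if (p ^ k == n)%N then ell p / (p ^ k)%:R else 0.
pose T n := \sum_(2 <= p < x.+1) \sum_(2 <= k < x.+1) t p k n.
have t_ge0 p k n : (2 <= p)%N -> 0 <= t p k n.
  by move=> p2; rewrite /t; case: eqP => // _; rewrite divr_ge0 ?ler0n ?log_ge0 //; lia.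
have s_ge0 p n : (2 <= p)%N -> 0 <= \sum_(2 <= k < x.+1) t p k n.
  by move=> p2; apply: sumr_ge0 => k _; apply: t_ge0.
have T_ge0 n : 0 <= T n.
  by rewrite /T big_nat_cond; apply: sumr_ge0 => p /andP[/andP[p2 _] _]; apply: s_ge0.
apply: (@le_trans _ _ (\sum_(1 <= n < x.+1) T n)).
  rewrite big_mkcond /=; apply: ler_sum_nat => n /andP[n_gt0 nx].
  case: ifP => [n_np|_]; last exact: T_ge0.
  case: (eqVneq (mangoldt n) 0) => [->|]; first by rewrite mul0r.
  case/(mangoldt_neq0 n_gt0) => p [k [p_pr Dn ->]].
  have p1 := prime_gt1 p_pr.
  have k_gt0 : (0 < k)%N.
    by case: k Dn n_np => // Dn; rewrite Dn expn1 p_pr.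
  have px : (2 <= p < x.+1)%N.
    by rewrite p1 (leq_ltn_trans _ nx) // Dn expnS leq_pmulr // expn_gt0 ltnW.
  have kx : (2 <= k.+1 < x.+1)%N.
    by rewrite !ltnS k_gt0 (leq_trans (ltnW (ltn_expl k.+1 p1))) // -Dn -ltnS.
  have -> : ell p / n%:R = t p k.+1 n by rewrite /t -Dn eqxx.
  rewrite /T (bigD1_seq p) ?mem_index_iota ?iota_uniq //=.
  rewrite (bigD1_seq k.+1) ?mem_index_iota ?iota_uniq //=.
  rewrite -addrA lerDl addr_ge0 //; first by apply: sumr_ge0 => j _; apply: t_ge0.
  rewrite big_nat_cond; apply: sumr_ge0 => q /andP[/andP[q2 _] _].
  exact: s_ge0.
rewrite /T exchange_big /=; apply: le_trans (sum_log_telescope x.+1).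
apply: ler_sum_nat => p /andP[p2 _]; rewrite exchange_big /=.
have l0 : 0 <= ell p by rewrite log_ge0 //; lia.
apply: (@le_trans _ _ (\sum_(2 <= k < x.+1) ell p * (p ^ k)%:R^-1)).
  apply: ler_sum_nat => k _; rewrite -big_mkcond /=.
  rewrite (eq_bigl (fun n => n == p ^ k)%N) => [|n]; last by rewrite eq_sym.
  rewrite -big_filter; case: (boolP ((p ^ k)%N \in index_iota 1 x.+1)) => h.
    by rewrite filter_pred1_uniq ?iota_uniq // big_seq1.
  have -> : [seq i <- index_iota 1 x.+1 | i == (p ^ k)%N] = [::].
    apply/eqP; rewrite -[_ == _]negbK -has_filter; apply/hasPn => i ih.
    by apply: contraNneq h => <-.
  by rewrite big_nil mulr_ge0 ?invr_ge0 ?ler0n.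
by rewrite -mulr_sumr ler_wpM2l ?sum_geometric_tail.
Qed.

End Logarithm.

(** * Sums twisted by a character *)

Local Open Scope complex_scope.

Lemma normc_ge0 (R : rcfType) (z : R[i]) : 0 <= normc z.
Proof. by case: z => a b; apply: sqrtr_ge0. Qed.

Lemma normc_real (R : rcfType) (r : R) : normc r%:C = `|r|.
Proof. by rewrite /= expr0n addr0 sqrtr_sqr. Qed.

Lemma le_normc_sum (R : rcfType) (I : Type) (r : seq I) (P : pred I) (F : I -> R[i]) :
  normc (\sum_(i <- r | P i) F i) <= \sum_(i <- r | P i) normc (F i).
Proof.
elim/big_rec2: _ => [|i x z _ h]; first by rewrite normc0.
by apply: le_trans (le_normcD _ _) _; rewrite lerD2l.
Qed.

Lemma le_normcB (R : rcfType) (z w : R[i]) : normc (z - w) <= normc z + normc w.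
Proof. by rewrite -(normcN w); apply: le_normcD. Qed.

(** All that the estimates need of a nonprincipal character: boundedness of its sums over intervals
    replaces periodicity. *)
Record bounded_character (R : rcfType) (chi : nat -> R[i]) (B : R) : Prop := {
  chi1 : chi 1%N = 1;
  chiM : forall m n, chi (m * n)%N = chi m * chi n;
  chi_le1 : forall n, normc (chi n) <= 1;
  chi_sum : forall m n, normc (\sum_(m <= k < n) chi k) <= B }.

Section TwistedSums.
Variables (R : rcfType) (ell : logarithm R) (chi : nat -> R[i]) (B : R).
Hypothesis chiB : bounded_character chi B.

Definition tsum (f : nat -> R) (x : nat) : R[i] :=
  \sum_(1 <= n < x.+1) chi n * (f n)%:C.

Lemma bound_ge0 : 0 <= B.
Proof. by apply: le_trans (chi_sum chiB 0 0); apply: normc_ge0. Qed.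

(** The partial sums of [chi] are bounded by [B], and the nonnegative decrements of [f]
    telescope. *)
Lemma abel_summation (f : nat -> R) (m n : nat) : 0 <= f m ->
  (forall k, (m <= k)%N -> 0 <= f k.+1 <= f k) ->
  normc (\sum_(m <= k < n) chi k * (f k)%:C) <= B * f m.
Proof.
move=> fm0 f_dec.
have f0 j : 0 <= f (m + j)%N.
  by case: j => [|j]; rewrite ?addn0 // addnS; case/andP: (f_dec (m + j)%N (leq_addr _ _)).
have [nm|/ltnW mn] := leqP n m.
  by rewrite big_geq // normc0 mulr_ge0 ?bound_ge0.
rewrite -(subnKC mn); move: (n - m)%N => j {n mn}.
pose s i := \sum_(m <= k < m + i) chi k.
have -> : \sum_(m <= k < m + j) chi k * (f k)%:C
   = s j * (f (m + j)%N)%:C + \sum_(0 <= i < j) s i.+1 * (f (m + i)%N - f (m + i.+1)%N)%:C.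
  elim: j => [|j IH]; first by rewrite /s addn0 !big_geq // mul0r addr0.
  rewrite addnS big_nat_recr ?leq_addr //= IH [in RHS]big_nat_recr //=.
  have -> : s j.+1 = s j + chi (m + j)%N by rewrite /s addnS big_nat_recr ?leq_addr.
  rewrite addnS rmorphB /=; ring.
apply: le_trans (le_normcD _ _) _; apply: (@le_trans _ _
  (B * f (m + j)%N + \sum_(0 <= i < j) B * (f (m + i)%N - f (m + i.+1)%N))).
  apply: lerD; first by rewrite normcM normc_real ger0_norm // ler_wpM2r // chi_sum.
  apply: le_trans (le_normc_sum _ _ _) _; apply: ler_sum_nat => i _.
  have fd : 0 <= f (m + i)%N - f (m + i.+1)%N.
    by rewrite subr_ge0 addnS; case/andP: (f_dec (m + i)%N (leq_addr _ _)).
  by rewrite normcM normc_real ger0_norm // ler_wpM2r // chi_sum.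
rewrite -mulr_sumr -mulrDr ler_wpM2l ?bound_ge0 // le_eqVlt; apply/orP; left; apply/eqP.
elim: j => [|j IH]; first by rewrite addn0 big_geq // addr0.
by rewrite big_nat_recr //= -[RHS]IH; ring.
Qed.

Lemma tsum_tail (f : nat -> R) (x y : nat) : (y <= x)%N -> 0 <= f y.+1 ->
  (forall k, (y < k)%N -> 0 <= f k.+1 <= f k) ->
  normc (tsum f x - tsum f y) <= B * f y.+1.
Proof.
move=> yx fy f_dec; rewrite /tsum (@big_cat_nat _ _ _ y.+1) //= [X in X - _]addrC addrK.
exact: abel_summation.
Qed.

(** Complete multiplicativity splits [chi n] as [chi d * chi (n / d)]. *)
Lemma tsum_convolution (u v : nat -> R) (x : nat) :
  tsum (fun n => \sum_(d <- divisors n) u d * v (n %/ d)%N) x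
  = \sum_(1 <= d < x.+1) chi d * (u d)%:C * tsum v (x %/ d)%N.
Proof.
transitivity (\sum_(1 <= n < x.+1) \sum_(d <- divisors n)
    (chi d * (u d)%:C * (chi (n %/ d)%N * (v (n %/ d)%N)%:C))).
  apply: eq_big_nat => n /andP[n0 _]; rewrite rmorph_sum mulr_sumr /=.
  apply: eq_big_seq => d; rewrite -dvdn_divisors // => dn.
  by rewrite -{1}(divnK dn) (chiM chiB) rmorphM /=; ring.
rewrite (sum_divisors_exchange (fun d m => chi d * (u d)%:C * (chi m * (v m)%:C))).
by apply: eq_bigr => d _; rewrite /tsum mulr_sumr.
Qed.

Lemma le_norm_twisted (u : nat -> R) (G : nat -> R[i]) (g : nat -> R) (x : nat) :
  (forall d, (0 < d <= x)%N -> `|u d| * normc (G d) <= g d) ->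
  normc (\sum_(1 <= d < x.+1) chi d * (u d)%:C * G d) <= \sum_(1 <= d < x.+1) g d.
Proof.
move=> h; apply: le_trans (le_normc_sum _ _ _) _; apply: ler_sum_nat => d dx.
apply: le_trans (h d dx); rewrite !normcM normc_real -mulrA.
by rewrite -[X in _ <= X]mul1r ler_wpM2r ?mulr_ge0 ?normc_ge0 ?normr_ge0 ?(chi_le1 chiB).
Qed.

(** [Lsum] truncates [L(1, chi)], and [Asum] the logarithmic derivative [- L' / L] at 1. *)
Definition Lsum := tsum (fun n => n%:R^-1).
Definition Asum := tsum (fun n => mangoldt ell n / n%:R).
Definition mobius_over (d : nat) : R := (mobius d)%:~R / d%:R.

Lemma norm_mobius_over d : `|mobius_over d| <= d%:R^-1.
Proof.
rewrite normrM normfV (ger0_norm (ler0n _ d)) -[X in _ <= X]mul1r.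
rewrite ler_wpM2r ?invr_ge0 ?ler0n //.
by rewrite -intr_norm -[1]/(1%:~R) ler_int norm_mobius.
Qed.

Lemma Lsum_tail x y : (y <= x)%N -> normc (Lsum x - Lsum y) <= B / y.+1%:R.
Proof.
move=> yx; apply: tsum_tail => //; first by rewrite invr_ge0 ler0n.
move=> k yk; rewrite invr_ge0 ler0n /= lef_pV2 ?posrE ?ltr0n ?ler_nat //.
by rewrite (leq_trans _ yk).
Qed.

Lemma invS_divn_le (x d : nat) : (0 < d)%N -> (0 < x)%N ->
  ((x %/ d).+1%:R)^-1 <= d%:R / x%:R :> R.
Proof.
move=> d0 x0; rewrite ler_pdivlMr ?ltr0n // mulrC ler_pdivrMr ?ltr0n //.
by rewrite -natrM ler_nat mulnC ltnW // ltn_ceil.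
Qed.

(** Finite form of [(1 / L) * L = 1], by Moebius inversion. *)
Lemma mobius_Lsum x : (0 < x)%N ->
  \sum_(1 <= d < x.+1) chi d * (mobius_over d)%:C * Lsum (x %/ d)%N = 1.
Proof.
move=> x0; rewrite -tsum_convolution /tsum big_ltn // big_seq1.
rewrite big1_seq => [|n /andP[_]].
  by rewrite (chi1 chiB) /mobius_over mobius1 divn1 !divr1 addr0 mulr1.
rewrite mem_index_iota => /andP[n1 _]; have n0 := ltnW n1.
rewrite (eq_big_seq (fun d => n%:R^-1 * (mobius d)%:~R)) => [|d].
  by rewrite -mulr_sumr sum_mobius_intr // gtn_eqF // !mulr0.
rewrite -dvdn_divisors // => dn; rewrite /mobius_over -mulrA -invfM -natrM.
by rewrite mulnC divnK // mulrC.
Qed.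

Lemma Asum_mobius x :
  Asum x = \sum_(1 <= d < x.+1) chi d * (mobius_over d)%:C * tsum (fun m => ell m / m%:R) (x %/ d)%N.
Proof.
rewrite -tsum_convolution; apply: eq_big_nat => n /andP[n0 _]; congr (_ * _%:C).
rewrite -sum_mobius_log // mulr_suml; apply: eq_big_seq => d.
rewrite -dvdn_divisors // => dn; rewrite /mobius_over -{2}(divnK dn) natrM invfM; ring.
Qed.

(** The weights [mobius d * (log x - log d)], summed over the divisors of [n], give [mangoldt n],
    plus [log x] at [n = 1]. This form suits the vanishing case, where every [Lsum] on the right is
    small. *)
Lemma Asum_log_mobius x : (0 < x)%N ->
  Asum x + (ell x)%:C = \sum_(1 <= d < x.+1)
    chi d * (mobius_over d * (ell x - ell d))%:C * Lsum (x %/ d)%N.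
Proof.
move=> x0; rewrite -tsum_convolution.
have -> : (ell x)%:C = tsum (fun n => if n == 1%N then ell x else 0) x.
  rewrite /tsum big_ltn // (chi1 chiB) mul1r big1_seq ?addr0 // => n /andP[_].
  by rewrite mem_index_iota => /andP[n1 _]; rewrite gtn_eqF // mulr0.
rewrite /Asum /tsum -big_split /=; apply: eq_big_nat => n /andP[n0 _].
rewrite -mulrDr -rmorphD /=; congr (_ * _%:C).
rewrite (eq_big_seq (fun d => n%:R^-1 * ((mobius d)%:~R * ell x - (mobius d)%:~R * ell d))) => [|d].
  rewrite -mulr_sumr sumrB -mulr_suml sum_mobius_intr // /mangoldt.
  by case: (n =P 1%N) => [->|_] /=; rewrite ?invr1; ring.
rewrite -dvdn_divisors // => dn; rewrite /mobius_over -{2}(divnK dn) natrM invfM; ring.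
Qed.

End TwistedSums.

(** * The dichotomy between vanishing and nonvanishing characters *)

Section Dichotomy.
Variables (R : rcfType) (ell : logarithm R) (chi : nat -> R[i]) (B : R).
Hypothesis chiB : bounded_character chi B.
Local Notation L := (Lsum chi).
Local Notation A := (Asum ell chi).
Local Notation H := (tsum chi (fun m => ell m / m%:R)).

(** [L(1, chi) = 0] without limits: by [Lsum_tail] the truncations are within [B / x.+1] of all
    later ones. *)
Definition vanishing := forall x, normc (L x) <= B / x.+1%:R.

(** The term of index [d] is at most [(1 / d) (log x - log d) (B d / x)], and [sum_log_diff] sums
    these to at most [B]. *)
Lemma Asum_vanishing : vanishing ->
  forall x, (0 < x)%N -> normc (A x + (ell x)%:C) <= B.
Proof.
move=> L0 x x_gt0; have B0 := bound_ge0 chiB.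
have x0 : (0 : R) < x%:R by rewrite ltr0n.
rewrite (Asum_log_mobius ell chiB x_gt0).
apply: le_trans (le_norm_twisted chiB (g := fun d => B / x%:R * (ell x - ell d)) _) _.
  move=> d /andP[d0 dx].
  have ld : 0 <= ell x - ell d by rewrite subr_ge0 le_log // d0.
  rewrite normrM (ger0_norm ld).
  have h1 : normc (L (x %/ d)%N) <= B * (d%:R / x%:R).
    by apply: le_trans (L0 _) _; rewrite ler_wpM2l ?invS_divn_le.
  apply: le_trans (ler_pM _ (normc_ge0 _) (ler_wpM2r ld (norm_mobius_over R d)) h1) _.
    by rewrite mulr_ge0.
  have d0' : (d%:R : R) != 0 by rewrite pnatr_eq0 -lt0n.
  by rewrite le_eqVlt; apply/orP; left; apply/eqP; field; rewrite d0' gt_eqF.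
rewrite -mulr_sumr -[X in _ <= X]mulr1 -mulrA ler_wpM2l //.
by rewrite mulrC ler_pdivrMr // mul1r sum_log_diff.
Qed.

(** The shift by 1 is needed because [log k / k] alone increases at first. *)
Lemma log_over_decreasing k : (0 < k)%N ->
  0 <= (ell k.+1 + 1) / k.+1%:R <= (ell k + 1) / k%:R.
Proof.
move=> k_gt0; have k0 : (0 : R) < k%:R by rewrite ltr0n.
have k1 : (0 : R) < k.+1%:R by rewrite ltr0n.
have l0 := log_ge0 ell k_gt0; have l1 := log_ge0 ell (ltn0Sn k).
apply/andP; split; first by rewrite divr_ge0 ?ler0n //; lra.
have /(log_incr ell)/andP[_] : (0 < k <= k.+1)%N by lia.
rewrite ler_pdivlMr // => h; rewrite ler_pdivrMr // mulrAC ler_pdivlMr //.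
by move: h; rewrite -natr1; lra.
Qed.

Lemma log_over_divn x d : (0 < d <= x)%N ->
  (ell (x %/ d).+1 + 1) / (x %/ d).+1%:R <= (ell x - ell d + 1) * (d%:R / x%:R).
Proof.
move=> /andP[d_gt0 dx]; have x_gt0 := leq_trans d_gt0 dx.
set m := (x %/ d).+1.
have x0 : (0 : R) < x%:R by rewrite ltr0n.
have m0 : (0 : R) < m%:R by rewrite ltr0n.
have xmd : (x <= m * d)%N by rewrite ltnW // ltn_ceil.
have /(log_incr ell)/andP[_] : (0 < x <= m * d)%N by rewrite x_gt0.
rewrite logM // natrM ler_pdivlMr // => h0; rewrite mulrA ler_pdivlMr // mulrAC ler_pdivrMr //.
have ld : 0 <= ell x - ell d by rewrite subr_ge0 le_log // d_gt0.
have h : x%:R <= m%:R * d%:R :> R by rewrite -natrM ler_nat.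
by have := ler_wpM2r ld h; lra.
Qed.

(** Abel summation applies separately to [(log m + 1) / m] and to [1 / m], whose difference is
    [log m / m]. *)
Lemma Hsum_tail x y : (y <= x)%N ->
  normc (H x - H y) <= B * ((ell y.+1 + 1) / y.+1%:R + y.+1%:R^-1).
Proof.
move=> yx; set G := tsum chi (fun m => (ell m + 1) / m%:R).
have HG z : H z = G z - L z.
  rewrite /G /Lsum /tsum -sumrB; apply: eq_bigr => n _.
  by rewrite -mulrBr -rmorphB /=; congr (_ * _%:C); ring.
have -> : H x - H y = (G x - G y) - (L x - L y) by rewrite !HG; ring.
apply: le_trans (le_normcB _ _) _; rewrite mulrDr; apply: lerD; last exact: Lsum_tail.
apply: (tsum_tail chiB yx).
  by rewrite divr_ge0 ?ler0n // addr_ge0 ?log_ge0.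
by move=> k yk; apply: log_over_decreasing; apply: leq_ltn_trans yk.
Qed.

(** The tail bound keeps [L x] away from 0 beyond [x0]. As [L x * M] is bounded, so is the twisted
    Moebius sum [M], and [A x] differs from [H x * M] by a bounded amount. *)
Lemma Asum_nonvanishing x0 : ~~ (normc (L x0) <= B / x0.+1%:R) ->
  exists K, forall x, (0 < x)%N -> (x0 <= x)%N -> normc (A x) <= K.
Proof.
rewrite -ltNge => Lx0; set dl := normc (L x0) - B / x0.+1%:R.
have dl_gt0 : 0 < dl by rewrite subr_gt0.
have B0 := bound_ge0 chiB.
(* [3 * B] pays for replacing [H (x %/ d)] by [H x], [2 * B] bounds [H x], and [(1 + B) / dl] bounds
   [M]. *)
exists (3 * B + 2 * B * ((1 + B) / dl)) => x x_gt0 x0x.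
have x0' : (0 : R) < x%:R by rewrite ltr0n.
have dL : dl <= normc (L x).
  have h1 := Lsum_tail chiB x0x.
  have := le_normcB (L x) (L x - L x0); rewrite opprB addrCA subrr addr0.
  by rewrite /dl; move: h1; move: (B / _) => e; lra.
pose M := tsum chi (mobius_over R) x.
have hM : normc (L x * M) <= 1 + B.
  have -> : L x * M = 1 + \sum_(1 <= d < x.+1) chi d * (mobius_over R d)%:C * (L x - L (x %/ d)%N).
    rewrite -{1}(mobius_Lsum chiB x_gt0) -big_split /M /tsum mulr_sumr /=.
    by apply: eq_bigr => d _; ring.
  apply: le_trans (le_normcD _ _) _; rewrite normc1 lerD2l.
  apply: le_trans (le_norm_twisted chiB (g := fun d => B / x%:R) _) _.
    move=> d /andP[d0 dx].
    have h1 : normc (L x - L (x %/ d)%N) <= B * (d%:R / x%:R).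
      apply: le_trans (Lsum_tail chiB (leq_div _ _)) _.
      by rewrite ler_wpM2l ?invS_divn_le.
    apply: le_trans (ler_pM _ (normc_ge0 _) (norm_mobius_over R d) h1) _ => //.
    have d0' : (d%:R : R) != 0 by rewrite pnatr_eq0 -lt0n.
    by rewrite le_eqVlt; apply/orP; left; apply/eqP; field; rewrite d0' gt_eqF.
  by rewrite sumr_const_nat subn1 /= -[X in X <= _]mulr_natr divfK // gt_eqF.
have hM' : normc M <= (1 + B) / dl.
  rewrite ler_pdivlMr // (le_trans _ hM) // normcM mulrC ler_wpM2r //.
  exact: normc_ge0.
have hH : normc (H x) <= 2 * B.
  have := Hsum_tail (leq0n x); rewrite {2}/tsum big_geq // subr0 log1 !divr1; lra.
have -> : A x = H x * M + \sum_(1 <= d < x.+1) chi d * (mobius_over R d)%:C * (H (x %/ d)%N - H x).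
  rewrite (Asum_mobius ell chiB) /M [X in _ * X]/tsum mulr_sumr -big_split /=.
  by apply: eq_bigr => d _; ring.
apply: le_trans (le_normcD _ _) _; rewrite addrC; apply: lerD; last first.
  by rewrite normcM ler_pM ?normc_ge0.
apply: le_trans (le_norm_twisted chiB (g := fun d => B / x%:R * (ell x - ell d + 2)) _) _.
  move=> d d0x; have /andP[d0 dx] := d0x.
  have h1 : normc (H (x %/ d)%N - H x) <= B * ((ell x - ell d + 2) * (d%:R / x%:R)).
    rewrite -normcN opprB.
    apply: le_trans (Hsum_tail (leq_div _ _)) _; rewrite ler_wpM2l //.
    apply: le_trans (lerD (log_over_divn d0x) (invS_divn_le R d0 x_gt0)) _.
    by rewrite -{2}[_ / x%:R]mul1r -mulrDl -addrA.
  apply: le_trans (ler_pM _ (normc_ge0 _) (norm_mobius_over R d) h1) _ => //.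
  have d0' : (d%:R : R) != 0 by rewrite pnatr_eq0 -lt0n.
  by rewrite le_eqVlt; apply/orP; left; apply/eqP; field; rewrite d0' gt_eqF.
rewrite -mulr_sumr big_split /= sumr_const_nat subn1 /= -(mulr_natr 2).
rewrite mulrAC ler_pdivrMr // -mulrA mulrCA ler_wpM2l //.
by have := sum_log_diff ell x; lra.
Qed.

End Dichotomy.

(** * Real characters *)

Section RealCharacter.
Variables (R : archiRcfType) (chi : nat -> R[i]) (B : R) (e : nat -> R).
Hypothesis chiB : bounded_character chi B.
Hypothesis chiE : forall n, chi n = (e n)%:C.
Hypothesis e_val : forall n, [|| e n == 0, e n == 1 | e n == -1].

Lemma real_charM m n : e (m * n)%N = e m * e n.
Proof. by apply: complexI; rewrite rmorphM /= -!chiE (chiM chiB). Qed.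

Lemma real_char1 : e 1 = 1.
Proof. by apply: complexI; rewrite -chiE (chi1 chiB). Qed.

Lemma real_charX m i : e (m ^ i)%N = e m ^+ i.
Proof. by elim: i => [|i IH]; rewrite ?real_char1 // expnS real_charM IH exprS. Qed.

Lemma norm_real_char n : `|e n| <= 1.
Proof. by case/or3P: (e_val n) => /eqP ->; rewrite ?normrN ?normr1 ?normr0. Qed.

Lemma sum_real_char_geometric p k :
  0 <= \sum_(0 <= i < k.+1) e p ^+ i /\ (~~ odd k -> 1 <= \sum_(0 <= i < k.+1) e p ^+ i).
Proof.
case/or3P: (e_val p) => /eqP ->.
- rewrite big_nat_recl // expr0 big1 ?addr0 ?ler01 // => i _.
  by rewrite exprS mul0r.
- rewrite (eq_bigr (fun=> 1)) => [|i _]; last by rewrite expr1n.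
  by rewrite sumr_const_nat ler0n ler1n.
- have -> : \sum_(0 <= i < k.+1) (-1) ^+ i = (~~ odd k)%:R :> R.
    elim: k => [|k IH]; first by rewrite big_nat1.
    rewrite big_nat_recr //= IH exprS -signr_odd.
    by case: (odd k) => /=; rewrite ?expr1 ?expr0 /=; ring.
  by case: (odd k).
Qed.

Definition char_divisor_sum n := \sum_(d <- divisors n) e d.

(** The divisor sum is the product over the primes of the geometric sums above; even valuations
    everywhere mean that [n] is a square. *)
Lemma char_divisor_sum_ge n : (0 < n)%N ->
  0 <= char_divisor_sum n /\ ((forall p, ~~ odd (logn p n)) -> 1 <= char_divisor_sum n).
Proof.
move: n; apply: prime_power_ind => [|p k m p_pr m_gt0 cpm [r0 r1]].
  by rewrite /char_divisor_sum big_seq1 real_char1.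
have p_gt0 := prime_gt0 p_pr.
have -> : char_divisor_sum (p ^ k.+1 * m) = (\sum_(0 <= i < k.+2) e p ^+ i) * char_divisor_sum m.
  rewrite /char_divisor_sum sum_divisors_prime_power // mulr_suml; apply: eq_bigr => i _.
  by rewrite mulr_sumr; apply: eq_bigr => d _; rewrite real_charM real_charX.
have [g0 g1] := sum_real_char_geometric p k.+1.
split=> [|sq]; first exact: mulr_ge0.
have lm q : logn q (p ^ k.+1 * m) = (k.+1 * (q == p) + logn q m)%N.
  by rewrite lognM ?expn_gt0 ?p_gt0 // lognX logn_prime // eq_sym.
rewrite -[1]mulr1 ler_pM ?ler01 //.
  by apply: g1; have := sq p; rewrite lm eqxx muln1 logn_coprime // addn0.
apply: r1 => q; have := sq q; rewrite lm; case: (q =P p) => [->|_].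
  by rewrite logn_coprime.
by rewrite muln0.
Qed.

Lemma abel_real_char (f : nat -> R) (m n : nat) : 0 <= f m ->
  (forall k, (m <= k)%N -> 0 <= f k.+1 <= f k) ->
  `|\sum_(m <= k < n) e k * f k| <= B * f m.
Proof.
move=> f0 fd; have := abel_summation chiB n f0 fd.
rewrite (eq_bigr (fun k => (e k * f k)%:C)) => [|k _]; last by rewrite rmorphM /= chiE.
by rewrite -rmorph_sum normc_real.
Qed.

(** The weight [X - n] smooths the cutoff at [X], which makes the inner sums of the hyperbola method
    precise up to [d]. *)
Definition weighted_divisor_sum X := \sum_(1 <= n < X.+1) char_divisor_sum n * (X - n)%N%:R.

(** Only the squares [m ^ 2] with [m <= T] are kept; each has weight at least [3 * T ^ 2]. *)
Lemma weighted_divisor_sum_lower T : 3 * T%:R ^+ 3 <= weighted_divisor_sum (4 * T ^ 2).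
Proof.
set X := (4 * T ^ 2)%N.
pose s m n : R := if (m ^ 2 == n)%N then (X - n)%N%:R else 0.
have s0 m n : 0 <= s m n by rewrite /s; case: ifP; rewrite ?ler0n.
apply: (@le_trans _ _ (\sum_(1 <= n < X.+1) \sum_(1 <= m < T.+1) s m n)); last first.
  apply: ler_sum_nat => n /andP[n_gt0 _].
  have [r0 r1] := char_divisor_sum_ge n_gt0.
  have [/hasP[m mT /eqP Dn]|/hasPn hn] := boolP (has (fun m => m ^ 2 == n)%N (index_iota 1 T.+1)).
    rewrite (bigD1_seq m) ?iota_uniq //= big1 ?addr0 => [|j jm].
      rewrite /s Dn eqxx -[X in X <= _]mul1r ler_wpM2r ?ler0n //.
      by apply: r1 => p; rewrite -Dn lognX mul2n odd_double.
    by rewrite /s -Dn eqn_exp2r // (negbTE jm).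
  rewrite big1_seq ?mulr_ge0 ?ler0n // => m /andP[_ mT].
  by rewrite /s (negbTE (hn m mT)).
rewrite exchange_big /=.
apply: (@le_trans _ _ (\sum_(1 <= m < T.+1) (3 * T ^ 2)%:R)).
  rewrite sumr_const_nat subn1 /= -[X in _ <= X]mulr_natr natrM natrX le_eqVlt.
  by apply/orP; left; apply/eqP; ring.
apply: ler_sum_nat => m /andP[m1 mT].
have mT2 : (m ^ 2 <= T ^ 2)%N by rewrite leq_exp2r.
rewrite (bigD1_seq (m ^ 2)%N) ?iota_uniq ?mem_index_iota //=; last first.
  by rewrite expn_gt0 m1 ltnS /X; lia.
rewrite {1}/s eqxx -[X in X <= _]addr0 lerD //; last by apply: sumr_ge0 => j _.
by rewrite ler_nat /X; lia.
Qed.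

(** Writing [X = q * d + s], the error is exactly [s * (1 - s / d) / 2]. *)
Lemma inner_sum_estimate X d : (0 < d)%N ->
  `|\sum_(1 <= k < (X %/ d).+1) (X - d * k)%N%:R - (X%:R ^+ 2 / 2 * d%:R^-1 - X%:R / 2)|
    <= d%:R :> R.
Proof.
move=> d_gt0; set q := (X %/ d)%N; set s := (X %% d)%N.
have d0 : (0 : R) < d%:R by rewrite ltr0n.
have DX : X%:R = q%:R * d%:R + s%:R :> R by rewrite -natrM -natrD -divn_eq.
have sd : (s%:R : R) < d%:R by rewrite ltr_nat ltn_pmod.
have s0 : (0 : R) <= s%:R by rewrite ler0n.
have -> : \sum_(1 <= k < q.+1) (X - d * k)%N%:R
   = X%:R * q%:R - d%:R * q%:R * (q%:R + 1) / 2 :> R.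
  have : (q * d <= X)%N by apply: leq_divM.
  elim: q {DX} => [|j IH] jd; first by rewrite big_geq // !(mulr0, mul0r) subr0.
  rewrite big_nat_recr //= IH; last by apply: leq_trans jd; rewrite leq_mul2r leqnSn orbT.
  rewrite natrB; last by rewrite mulnC.
  by rewrite natrM -natr1; field.
rewrite DX.
have -> : (q%:R * d%:R + s%:R) * q%:R - d%:R * q%:R * (q%:R + 1) / 2
   - ((q%:R * d%:R + s%:R) ^+ 2 / 2 * d%:R^-1 - (q%:R * d%:R + s%:R) / 2)
   = s%:R * (1 - s%:R / d%:R) / 2 :> R by field; rewrite gt_eqF.
have t0 : 0 <= s%:R / d%:R :> R by rewrite divr_ge0 // ltW.
have t1 : s%:R / d%:R <= 1 :> R by rewrite ler_pdivrMr // mul1r ltW.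
move: (s%:R / d%:R) t0 t1 => t t0 t1.
rewrite ger0_norm; last by rewrite !mulr_ge0 ?invr_ge0 ?ler0n // subr_ge0.
nra.
Qed.

(** Hyperbola method cut at [D]. For [d <= D] the inner sums are evaluated: the first three terms
    come from vanishing, from the bounded character sum, and from the errors. For [d > D] the sum
    over [d] is taken first, by Abel summation, for each of the at most [X / D] values of [k]. *)
Lemma weighted_divisor_sum_upper X D : vanishing chi B -> (0 < D <= X)%N ->
  weighted_divisor_sum X <=
    X%:R ^+ 2 / 2 * (B / D%:R) + X%:R / 2 * B + D%:R ^+ 2 + X%:R ^+ 2 / D%:R * B.
Proof.
move=> chi0 /andP[D_gt0 DX]; have B0 := bound_ge0 chiB.
have D0 : (0 : R) < D%:R by rewrite ltr0n.
pose S d : R := \sum_(1 <= k < (X %/ d).+1) (X - d * k)%N%:R.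
have -> : weighted_divisor_sum X = \sum_(1 <= d < X.+1) e d * S d.
  rewrite /weighted_divisor_sum (eq_big_nat _ _
    (F2 := fun n => \sum_(d <- divisors n) e d * (X - d * (n %/ d))%N%:R)).
    rewrite (sum_divisors_exchange (fun d m => e d * (X - d * m)%N%:R)).
    by apply: eq_bigr => d _; rewrite /S mulr_sumr.
  move=> n /andP[n0 _]; rewrite /char_divisor_sum mulr_suml; apply: eq_big_seq => d.
  by rewrite -dvdn_divisors // => dn; rewrite [(d * _)%N]mulnC divnK.
rewrite (@big_cat_nat _ _ _ D.+1) //=.
apply: lerD.
  have -> : \sum_(1 <= d < D.+1) e d * S d
    = X%:R ^+ 2 / 2 * (\sum_(1 <= d < D.+1) e d * d%:R^-1) - X%:R / 2 * (\sum_(1 <= d < D.+1) e d)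
      + \sum_(1 <= d < D.+1) e d * (S d - (X%:R ^+ 2 / 2 * d%:R^-1 - X%:R / 2)).
    rewrite !mulr_sumr -sumrB -big_split /=; apply: eq_bigr => d _; ring.
  apply: lerD; first apply: lerD.
  - rewrite ler_wpM2l ?divr_ge0 ?exprn_ge0 ?ler0n //.
    have := chi0 D; rewrite /Lsum /tsum (eq_bigr (fun k => (e k * k%:R^-1)%:C)) => [|k _]; last first.
      by rewrite rmorphM /= chiE.
    rewrite -rmorph_sum normc_real => /(le_trans (ler_norm _)) /le_trans; apply.
    by rewrite ler_wpM2l // lef_pV2 ?posrE ?ltr0n // ler_nat.
  - rewrite -mulrN ler_wpM2l ?divr_ge0 ?ler0n //.
    have := chi_sum chiB 1 D.+1; rewrite (eq_bigr (fun k => (e k)%:C)) => [|k _]; last by rewrite chiE.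
    by rewrite -rmorph_sum normc_real -normrN => /(le_trans (ler_norm _)).
  - apply: le_trans (ler_norm _) _; apply: le_trans (ler_norm_sum _ _ _) _.
    apply: (@le_trans _ _ (\sum_(1 <= d < D.+1) D%:R)).
      apply: ler_sum_nat => d /andP[d0 dD]; rewrite normrM -[X in _ <= X]mul1r.
      rewrite ler_pM ?normr_ge0 ?norm_real_char // (le_trans (inner_sum_estimate X d0)) //.
      by rewrite ler_nat.
    by rewrite sumr_const_nat subn1 /= -[X in X <= _]mulr_natr expr2.
set Q := (X %/ D)%N.
(* Truncated subtraction makes [X - d * k] zero once [d * k > X], so [k] may run up to [Q] for every
   [d]. *)
have -> : \sum_(D.+1 <= d < X.+1) e d * S d
   = \sum_(1 <= k < Q.+1) \sum_(D.+1 <= d < X.+1) e d * (X - d * k)%N%:R.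
  rewrite exchange_big /=; apply: eq_big_nat => d /andP[Dd dX].
  have d0 : (0 < d)%N by apply: leq_ltn_trans Dd.
  have qQ : (X %/ d <= Q)%N by rewrite leq_div2l // ltnW.
  rewrite /S [in RHS](@big_cat_nat _ _ _ (X %/ d).+1) //= [X in _ = _ + X]big1_seq; last first.
    move=> k /andP[_]; rewrite mem_index_iota => /andP[k1 _].
    have -> : (X - d * k)%N = 0%N; last by rewrite mulr0.
    by apply/eqP; rewrite subn_eq0 mulnC ltnW // -ltn_divLR.
  by rewrite addr0 mulr_sumr.
apply: (@le_trans _ _ (\sum_(1 <= k < Q.+1) B * X%:R)).
  apply: ler_sum_nat => k /andP[k0 _].
  apply: le_trans (ler_norm _) _.
  apply: le_trans (abel_real_char (f := fun d => (X - d * k)%N%:R) X.+1 _ _) _ => //.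
    by move=> d _; rewrite ler0n ler_nat leq_sub2l // leq_mul2r leqnSn orbT.
  by rewrite ler_wpM2l // ler_nat leq_subr.
rewrite sumr_const_nat subn1 /= -[X in X <= _]mulr_natr.
have : (Q%:R : R) * D%:R <= X%:R by rewrite -natrM ler_nat leq_divM.
rewrite -ler_pdivlMr // => QD.
have -> : X%:R ^+ 2 / D%:R * B = B * X%:R * (X%:R / D%:R) by ring.
by rewrite ler_wpM2l // mulr_ge0 ?ler0n.
Qed.

(* [X = 4 T^2] against the cut [D = 2 K T]: the lower bound [3 T^3] beats [12 B T^3 / K + O(T^2)]. *)
Lemma real_nonvanishing : ~ vanishing chi B.
Proof.
move=> chi0; have B0 := bound_ge0 chiB.
have [K hK] : exists K : nat, 12 * B + 1 <= K%:R.
  exists (Num.bound (12 * B + 1)); rewrite ltW // archi_boundP //; lra.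
have K_gt0 : (0 < K)%N by rewrite -(ltr_nat R); lra.
(* This size of [T] keeps the lower order terms [2 * B + 4 * K ^ 2] below [2 * T]. *)
have [T defT] : {T | T = 3 * K ^ 2}%N by exists (3 * K ^ 2)%N.
have DX : (0 < 2 * K * T <= 4 * T ^ 2)%N by rewrite defT; nia.
have := le_trans (weighted_divisor_sum_lower T) (weighted_divisor_sum_upper chi0 DX).
have DT : T%:R = 3 * K%:R ^+ 2 :> R by rewrite defT natrM natrX.
rewrite !natrM -!expr2.
have T0 : (0 : R) < T%:R by rewrite ltr0n defT; nia.
have K1 : (1 : R) <= K%:R by rewrite ler1n.
move: (T%:R : R) (K%:R : R) DT T0 K1 hK => t k Dt t0 k1 hK.
rewrite [X in _ <= X](_ : _ = t ^+ 2 * (12 * (B / k) * t + 2 * B + 4 * k ^+ 2)); last first.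
  by field; rewrite !gt_eqF //; lra.
have -> : 3 * t ^+ 3 = t ^+ 2 * (3 * t) by ring.
rewrite ler_pM2l ?exprn_gt0 // => h.
have h1 : 12 * (B / k) <= 1 by rewrite mulrA ler_pdivrMr; lra.
have h2 : 12 * (B / k) * t <= 1 * t by rewrite ler_wpM2r // ltW.
have : k <= k ^+ 2 by rewrite expr2 ler_peMl //; lra.
lra.
Qed.

End RealCharacter.

(** * Dirichlet characters *)

(** Full periods cancel, and fewer than [N] terms of norm at most 1 remain. *)
Lemma periodic_sum_le (R : rcfType) (f : nat -> R[i]) (N : nat) : (0 < N)%N ->
  (forall n, f (n + N)%N = f n) -> \sum_(0 <= k < N) f k = 0 ->
  (forall n, normc (f n) <= 1) ->
  forall m n, normc (\sum_(m <= k < n) f k) <= N%:R.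
Proof.
move=> N_gt0 f_per f_sum0 f_le1.
have period m : \sum_(m <= k < m + N) f k = 0.
  elim: m => [|m IH]; first by rewrite add0n.
  rewrite addSn big_nat_recr /=; last by lia.
  rewrite f_per -[RHS]IH [in RHS]big_ltn; first by rewrite addrC.
  by lia.
have short m j : (j <= N)%N -> normc (\sum_(m <= k < m + j) f k) <= N%:R.
  move=> jN; apply: le_trans (le_normc_sum _ _ _) _.
  apply: (@le_trans _ _ (\sum_(m <= k < m + j) 1)).
    by apply: ler_sum_nat => k _.
  by rewrite sumr_const_nat addKn ler_nat.
move=> m n; have [nm|/ltnW mn] := leqP n m; first by rewrite big_geq // normc0 ler0n.
rewrite -(subnKC mn); move: (n - m)%N => j {n mn}.
elim/ltn_ind: j m => j IH m; have [/short //|Nj] := leqP j N.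
rewrite (@big_cat_nat _ _ _ (m + N)) ?leq_addr //=; last by rewrite leq_add2l ltnW.
rewrite period add0r -(subnKC (ltnW Nj)) addnA; apply: IH; lia.
Qed.

Lemma primitive_root_exists (F : numClosedFieldType) n : (0 < n)%N ->
  exists z : F, n.-primitive_root z.
Proof.
pose p : {poly F} := 'X^n - 1; have [r Dp] := closed_field_poly_normal p.
move=> n_gt0; rewrite (monicP _) ?monicXnsubC // scale1r in Dp.
have rn1 : all n.-unity_root r by apply/allP=> z; rewrite -root_prod_XsubC -Dp.
have sz_r : (n < (size r).+1)%N by rewrite -(size_prod_XsubC r id) -Dp size_XnsubC.
have [|z] := hasP (has_prim_root n_gt0 rn1 _ sz_r); last by exists z.
by rewrite -separable_prod_XsubC -Dp separable_Xn_sub_1 // pnatr_eq0 -lt0n.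
Qed.

(* Character theory lives over [algC]; its roots of unity are carried into another closed field by sending one primitive root to another. *)
Lemma unity_root_transfer (F : numClosedFieldType) n : (0 < n)%N ->
  exists tau : algC -> F, forall x, x ^+ n = 1 ->
    [/\ tau x ^+ n = 1, tau x = 1 -> x = 1
      & forall y, y ^+ n = 1 -> tau (x * y) = tau x * tau y].
Proof.
move=> n_gt0; have [z zP] := C_prim_root_exists n_gt0.
have [w wP] := primitive_root_exists F n_gt0.
pose tau x := oapp (fun i : 'I_n => w ^+ i) 0 [pick i : 'I_n | x == z ^+ i].
have tauE k : tau (z ^+ k) = w ^+ k.
  rewrite /tau; case: pickP => [i /=|none].
    by rewrite (eq_prim_root_expr zP) => h; apply/eqP; rewrite (eq_prim_root_expr wP) eq_sym.
  have := none (Ordinal (ltn_pmod k n_gt0)).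
  by rewrite /= (prim_expr_mod zP) eqxx.
exists tau => x /(prim_rootP zP)[i ->]; split.
- by rewrite tauE exprAC (prim_expr_order wP) expr1n.
- move/eqP; rewrite tauE -(expr0 w) (eq_prim_root_expr wP) -(eq_prim_root_expr zP).
  by move/eqP.
by move=> y /(prim_rootP zP)[j ->]; rewrite -exprD !tauE exprD.
Qed.

(** The kernels of the linear characters intersect in the derived subgroup, which is trivial
    here. *)
Lemma separating_linear_char (gT : finGroupType) (G : {group gT}) g :
  abelian G -> g \in G -> (forall phi : 'CF(G), phi \is a linear_char -> phi g = 1) -> g = 1%g.
Proof.
move=> abG gG h; apply/set1gP.
rewrite -(derG1P abG) -cap_cfker_lin_irr.
by apply/bigcapP => i lin_i; rewrite cfkerEirr inE lin_char1 // h.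
Qed.

Lemma normc_unity_root (R : rcfType) (z : R[i]) n : (0 < n)%N -> z ^+ n = 1 -> normc z = 1.
Proof.
move=> n_gt0 zn; apply/eqP; rewrite -(@pexpr_eq1 _ _ n) ?normc_ge0 //.
have -> : normc z ^+ n = normc (z ^+ n).
  by elim: n {n_gt0 zn} => [|k IH]; rewrite ?normc1 // !exprS normcM IH.
by rewrite zn normc1.
Qed.

Lemma conjc_norm1 (R : rcfType) (z : R[i]) : normc z = 1 -> z * conjc z = 1.
Proof.
case: z => a b; rewrite /= => h; have {h} : a ^+ 2 + b ^+ 2 = 1.
  by rewrite -(sqr_sqrtr (addr_ge0 (sqr_ge0 a) (sqr_ge0 b))) h expr1n.
move=> h; apply/eqP; rewrite eq_complex /=; apply/andP; split; apply/eqP; last by ring.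
by rewrite -h; ring.
Qed.

(** The index type carries the group law of the character group, so conjugation becomes inversion of
    indices and a character can be paired with its conjugate. *)
Record dirichlet_characters (R : rcfType) (N : nat) (I : finGroupType)
    (X : I -> nat -> R[i]) : Prop := {
  dchar_coprime : forall i n, coprime N n -> normc (X i n) = 1;
  dchar_ncoprime : forall i n, ~~ coprime N n -> X i n = 0;
  dchar_principal : forall n, X 1%g n = (coprime N n)%:R;
  dchar_inv : forall i n, X i^-1%g n = conjc (X i n);
  dchar_inj : forall i, X i =1 X 1%g -> i = 1%g;
  dchar_bounded : forall i, i != 1%g -> bounded_character (X i) N%:R;
  dchar_orthogonal : forall a n, coprime N a ->
    \sum_i conjc (X i a) * X i n = if n == a %[mod N] then #|I|%:R else 0 }.

(** The linear characters of the unit group modulo [N], transferred from [algC] to [R[i]] and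
    extended by 0. *)
Lemma dirichlet_characters_exist (R : rcfType) (N : nat) : (1 < N)%N ->
  exists (I : finGroupType) (X : I -> nat -> R[i]), dirichlet_characters N X.
Proof.
case: N => [|[|N0]] // _; set N := N0.+2.
pose G := units_Zp N.
have abG : abelian G := units_Zp_abelian N.
have GT (g : {unit 'Z_N}) : g \in G by rewrite inE.
have [I [cF [cF_inj _ cF_lin cF_onto] [cF1 cFM _ cFV _]]] := lin_char_group [set: {unit 'Z_N}].
have [tau tauP] := unity_root_transfer (R[i] : numClosedFieldType) (cardG_gt0 [set: {unit 'Z_N}]).
set e := #|_| in tauP.
have cFe u g : cF u g ^+ e = 1.
  have /dvdnP[k ->] : (#[g]%g %| e)%N by apply: order_dvdG; rewrite inE.
  by rewrite mulnC exprM lin_char_unity_root ?inE ?expr1n // cF_lin.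
pose f u g := tau (cF u g).
have fM u v g : f (u * v)%g g = f u g * f v g.
  by rewrite /f cFM cfunE; case: (tauP _ (cFe u g)) => _ _; apply.
have fM2 u g h : f u (g * h)%g = f u g * f u h.
  by rewrite /f lin_charM ?inE ?cF_lin //; case: (tauP _ (cFe u g)) => _ _; apply.
have fe u g : f u g ^+ e = 1 by case: (tauP _ (cFe u g)).
have e_gt0 : (0 < e)%N by apply: cardG_gt0.
have f_norm u g : normc (f u g) = 1 by apply: normc_unity_root (fe u g).
have f_neq0 u g : f u g != 0.
  by apply/eqP => f0; have := f_norm u g; rewrite f0 normc0; move/eqP; rewrite eq_sym oner_eq0.
have f_1g u : f u 1%g = 1.
  by apply: (mulfI (f_neq0 u 1%g)); rewrite -fM2 mulg1 mulr1.
have f_1u g : f 1%g g = 1.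
  by apply: (mulfI (f_neq0 1%g g)); rewrite -fM mulg1 mulr1.
have f_eq1 u g : f u g = 1 -> cF u g = 1 by case: (tauP _ (cFe u g)).
have fV u g : f u^-1%g g = conjc (f u g).
  by apply: (mulfI (f_neq0 u g)); rewrite -fM mulgV f_1u conjc_norm1.
pose Y u (x : 'Z_N) : R[i] := oapp (f u) 0 (insub x : option {unit 'Z_N}).
have YU u (g : {unit 'Z_N}) : Y u (val g) = f u g by rewrite /Y valK.
have Y0 u x : x \isn't a GRing.unit -> Y u x = 0.
  by move=> h; rewrite /Y insubN.
have unitP (x : 'Z_N) : x \is a GRing.unit -> exists g : {unit 'Z_N}, x = val g.
  by move=> h; exists (Sub x h : {unit 'Z_N}); rewrite SubK.
have YM u x y : Y u (x * y) = Y u x * Y u y.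
  have [/unitP[g ->]|nx] := boolP (x \is a GRing.unit); last first.
    by rewrite (Y0 _ _ nx) mul0r Y0 // unitrM (negbTE nx).
  have [/unitP[h ->]|ny] := boolP (y \is a GRing.unit); last first.
    by rewrite (Y0 _ _ ny) mulr0 Y0 // unitrM (negbTE ny) andbF.
  by rewrite -(_ : val (g * h)%g = val g * val h) // !YU fM2.
have nU n : ((n%:R : 'Z_N) \is a GRing.unit) = coprime N n by rewrite unitZpE.
have Y_le1 u x : normc (Y u x) <= 1.
  have [/unitP[g ->]|nx] := boolP (x \is a GRing.unit); first by rewrite YU f_norm.
  by rewrite Y0 // normc0 ler01.
have nontrivial u : u != 1%g -> exists g, f u g != 1.
  move=> u1; apply/existsP; apply: contraR u1; rewrite negb_exists => /forallP h.
  apply/eqP/cF_inj; rewrite cF1; apply/cfun_inP => g gG; rewrite cfun1E gG /=.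
  by apply: f_eq1; apply/eqP; rewrite -[_ == _]negbK h.
(* Translating by a unit [g] with [f u g != 1] multiplies the sum by [f u g] without changing it. *)
have YsumZ u : u != 1%g -> \sum_x Y u x = 0.
  case/nontrivial => g g1; apply/eqP; have : (f u g - 1) * (\sum_x Y u x) = 0.
    rewrite mulrBl mul1r [X in _ - X](reindex_inj (mulrI (valP g))) /= mulr_sumr.
    by rewrite -sumrB big1 // => x _; rewrite YM YU subrr.
  by move/eqP; rewrite mulf_eq0 subr_eq0 (negbTE g1).
exists I, (fun u n => Y u n%:R); split.
- by move=> u n; rewrite -nU => /unitP[g ->]; rewrite YU f_norm.
- by move=> u n; rewrite -nU; apply: Y0.
- move=> n; rewrite -nU; have [/unitP[g ->]|nx] := boolP (_ \is a GRing.unit).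
    by rewrite YU f_1u.
  by rewrite Y0.
- move=> u n; have [/unitP[g ->]|nx] := boolP ((n%:R : 'Z_N) \is a GRing.unit).
    by rewrite !YU fV.
  by rewrite !Y0 // conjc0.
- move=> u Yu; apply/eqP; apply: contraT => /nontrivial[g /eqP[]].
  by have := Yu (nat_of_ord (val g)); rewrite natr_Zp !YU f_1u.
- move=> u u1; split.
  + have -> : (1%:R : 'Z_N) = val (1%g : {unit 'Z_N}) by [].
    by rewrite YU f_1g.
  + by move=> m n; rewrite natrM YM.
  + by [].
  + apply: periodic_sum_le => // [n|].
      by rewrite natrD pchar_Zp // addr0.
    rewrite big_mkord -[RHS](YsumZ u u1); apply: eq_bigr => x _.
    by rewrite natr_Zp.
- move=> a n; rewrite -nU => aU.
  have /unitP[ga ga_eq] := aU.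
  have -> : (n == a %[mod N]) = ((n%:R : 'Z_N) == a%:R).
    by rewrite -(inj_eq val_inj) /= !val_Zp_nat.
  have [/unitP[gn gn_eq]|nx] := boolP ((n%:R : 'Z_N) \is a GRing.unit); last first.
    rewrite big1 => [|u _]; last by rewrite (Y0 _ _ nx) mulr0.
    by case: eqP => // h; rewrite h aU in nx.
  rewrite ga_eq gn_eq (inj_eq val_inj).
  rewrite (eq_bigr (fun u => f u (ga^-1 * gn)%g)) => [|u _]; last first.
    rewrite !YU fM2; congr (_ * _); apply: (mulfI (f_neq0 u ga)).
    by rewrite conjc_norm1 // -fM2 mulgV f_1g.
  case: (gn =P ga) => [->|neq].
    rewrite (eq_bigr (fun=> 1)) => [|u _]; last by rewrite mulVg f_1g.
    by rewrite sumr_const.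
  (* The dual argument: some character separates the two distinct units, and translating the sum
     over characters by it makes the sum vanish. *)
  have [v v1] : exists v, f v (ga^-1 * gn)%g != 1.
    apply/existsP; apply: contraT; rewrite negb_exists => /forallP h.
    case: neq; apply: (mulgI ga^-1%g); rewrite mulVg.
    apply: (separating_linear_char (G := [set: {unit 'Z_N}]) abG); first exact: GT.
    move=> phi /cF_onto[u ->]; apply: f_eq1; apply/eqP.
    by rewrite -[_ == _]negbK h.
  apply/eqP; set S := \sum_u _; have : (f v (ga^-1 * gn)%g - 1) * S = 0.
    rewrite mulrBl mul1r [X in _ - X](reindex_inj (mulgI v)) /= mulr_sumr.
    by rewrite -sumrB big1 // => u _; rewrite fM subrr.
  by move/eqP; rewrite mulf_eq0 subr_eq0 (negbTE v1).
Qed.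

(** * Dirichlet's theorem *)

Local Notation Re := (@complex.Re _).

Lemma Re_le_normc (R : rcfType) (z : R[i]) : Re z <= normc z.
Proof.
case: z => a b /=; apply: le_trans (ler_norm _) _.
by rewrite -sqrtr_sqr ler_wsqrtr // lerDl sqr_ge0.
Qed.

Lemma normcJ (R : rcfType) (z : R[i]) : normc (conjc z) = normc z.
Proof. by case: z => a b /=; rewrite sqrrN. Qed.

Lemma Re_sum (R : rcfType) (I : finType) (F : I -> R[i]) :
  Re (\sum_i F i) = \sum_i Re (F i).
Proof. by elim/big_rec2: _ => // i x [a b] _ <-; case: (F i). Qed.

Section Dirichlet.
Variables (R : archiRcfType) (ell : logarithm R) (N : nat) (I : finGroupType).
Variable X : I -> nat -> R[i].
Hypothesis N_gt1 : (1 < N)%N.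
Hypothesis XP : dirichlet_characters N X.
Local Notation A i := (Asum ell (X i)).
Local Notation lam n := (mangoldt ell n / n%:R).

Lemma mangoldt_over_ge0 n : 0 <= lam n.
Proof. by rewrite divr_ge0 ?mangoldt_ge0 ?ler0n. Qed.

Lemma Asum_orthogonal a x : coprime N a ->
  \sum_i conjc (X i a) * A i x
  = (#|I|%:R * \sum_(1 <= n < x.+1 | n == a %[mod N]) lam n)%:C.
Proof.
move=> cNa; rewrite (eq_bigr (fun i => \sum_(1 <= n < x.+1) conjc (X i a) * X i n * (lam n)%:C)) => [|i _].
  rewrite exchange_big /= [X in _ = (_ * X)%:C]big_mkcond /= mulr_sumr rmorph_sum /=.
  apply: eq_bigr => n _; rewrite -mulr_suml (dchar_orthogonal XP) //.
  case: ifP => _; rewrite ?mul0r ?mulr0 //.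
  by rewrite [in RHS]rmorphM rmorph_nat.
by rewrite /Asum /tsum mulr_sumr; apply: eq_bigr => n _; rewrite mulrA.
Qed.

Lemma Asum_principal x :
  A 1%g x = (\sum_(1 <= n < x.+1 | coprime N n) lam n)%:C.
Proof.
rewrite /Asum /tsum rmorph_sum [RHS]big_mkcond /=; apply: eq_bigr => n _.
by rewrite (dchar_principal XP); case: ifP => _; rewrite ?mul1r ?mul0r.
Qed.

Lemma principal_upper x : (0 < x)%N ->
  \sum_(1 <= n < x.+1 | coprime N n) lam n <= 3 / 2 * ell (2 * x)%N.
Proof.
move=> x0; apply: le_trans (mertens_upper ell x0).
rewrite big_mkcond /=; apply: ler_sum => n _.
by case: ifP => // _; apply: mangoldt_over_ge0.
Qed.

(** The constant 3 is 1 from [mertens_lower] plus 2 for the nonprimes; the remaining noncoprime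
    terms are primes dividing [N], hence at most [N]. *)
Lemma principal_lower x : (0 < x)%N ->
  ell x - (3 + \sum_(1 <= n < N.+1) lam n) <= \sum_(1 <= n < x.+1 | coprime N n) lam n.
Proof.
move=> x0; have := mertens_lower ell x0.
rewrite (bigID (coprime N)) /=.
suff : \sum_(1 <= n < x.+1 | ~~ coprime N n) lam n <= 2 + \sum_(1 <= n < N.+1) lam n by lra.
rewrite (bigID (fun n => ~~ prime n)) /=; apply: lerD.
  apply: le_trans (sum_mangoldt_nonprime ell x).
  rewrite big_mkcond [X in _ <= X]big_mkcond /=; apply: ler_sum => n _.
  by case: (prime n) => /=; rewrite ?andbF // andbT; case: ifP => // _; apply: mangoldt_over_ge0.
pose g n := if (n <= N)%N then lam n else 0.
have g0 n : 0 <= g n by rewrite /g; case: ifP => // _; apply: mangoldt_over_ge0.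
apply: (@le_trans _ _ (\sum_(1 <= n < x.+1) g n)).
  rewrite big_mkcond /=; apply: ler_sum_nat => n /andP[n0 _].
  case: ifP => [/andP[ncop /negPn n_pr]|_]; last exact: g0.
  rewrite /g ifT ?lexx // dvdn_leq //; first exact: ltnW.
  by move: ncop; rewrite coprime_sym prime_coprime // negbK.
apply: (@le_trans _ _ (\sum_(1 <= n < (maxn x N).+1) g n)).
  rewrite [X in _ <= X](@big_cat_nat _ _ _ x.+1) //= ?ltnS ?leq_maxl //.
  by rewrite lerDl sumr_ge0.
rewrite (@big_cat_nat _ _ _ N.+1) //= ?ltnS ?leq_maxr //.
rewrite [X in _ + X]big1_seq => [|n /andP[_]].
  by rewrite addr0; apply: ler_sum => n _; rewrite /g; case: ifP => // _; apply: mangoldt_over_ge0.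
by rewrite mem_index_iota /g => /andP[Nn _]; rewrite leqNgt Nn.
Qed.

(** Such a character is real, so its values are 0, 1 or -1. *)
Lemma self_conjugate_nonvanishing i :
  i != 1%g -> i^-1%g = i -> ~ vanishing (X i) N%:R.
Proof.
move=> i1 iV; have Xreal n : X i n = (Re (X i n))%:C.
  have := dchar_inv XP i n; rewrite iV; case: (X i n) => a b /= [h].
  by have -> : b = 0 by lra.
apply: (@real_nonvanishing _ _ _ (fun n => Re (X i n))) => //.
  exact: (dchar_bounded XP).
move=> n; have [cop|ncop] := boolP (coprime N n); last by rewrite (dchar_ncoprime XP) // eqxx.
have := dchar_coprime XP i cop; rewrite Xreal normc_real.
by move/eqP; rewrite eqr_norml ler01 andbT => ->; rewrite orbT.
Qed.

Lemma vanishing_inv i : vanishing (X i) N%:R -> vanishing (X i^-1%g) N%:R.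
Proof.
move=> van x; have -> : Lsum (X i^-1%g) x = conjc (Lsum (X i) x).
  rewrite /Lsum /tsum rmorph_sum; apply: eq_bigr => n _.
  by rewrite rmorphM /= (dchar_inv XP) oppr0.
by rewrite normcJ.
Qed.

Lemma log_double x : (0 < x)%N -> ell (2 * x)%N = ell 2 + ell x.
Proof. exact: logM. Qed.

Lemma unbounded_from (c : R) (x0 : nat) : exists x, [/\ (0 < x)%N, (x0 <= x)%N & c < ell x].
Proof.
have [n n_gt0 cn] := log_unbounded ell c; exists (maxn n x0); split.
- by rewrite leq_max n_gt0.
- exact: leq_maxr.
- by apply: lt_le_trans cn _; rewrite le_log // n_gt0 leq_maxl.
Qed.

(** An upper bound holds on both sides of the dichotomy, since vanishing only pulls the sum down.
    The pair [K] holds the bound and the threshold, to be chosen together for all characters. *)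
Lemma Re_Asum_le i : i != 1%g ->
  exists K : R * nat, forall x, (0 < x)%N -> (K.2 <= x)%N -> Re (A i x) <= K.1.
Proof.
move=> i1; have chiB := dchar_bounded XP i1.
have [van|nvan] := classic (vanishing (X i) N%:R).
  exists (N%:R, 0%N) => x x_gt0 _ /=.
  have := le_trans (Re_le_normc _) (Asum_vanishing ell chiB van x_gt0).
  have := log_ge0 ell x_gt0; case: (A i x) => a b /=; lra.
have [x0 /negP h] := not_all_ex_not _ _ nvan.
have [K hK] := Asum_nonvanishing ell chiB h.
by exists (K, x0) => x x_gt0 x0x; apply: le_trans (Re_le_normc _) (hK x x_gt0 x0x).
Qed.

(** The two conjugate characters contribute [- 2 log x], the principal one at most [3 / 2 log x] up
    to a constant, and the others are bounded above; but the total is nonnegative by orthogonality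
    at 1. *)
Lemma complex_nonvanishing i :
  i != 1%g -> i^-1%g != i -> ~ vanishing (X i) N%:R.
Proof.
move=> i1 iV van; set j := i^-1%g in iV.
have j1 : j != 1%g by rewrite invg_eq1.
have vanj : vanishing (X j) N%:R := vanishing_inv van.
have /fin_all_exists[K hK] k : exists K : R * nat, k != 1%g ->
    forall x, (0 < x)%N -> (K.2 <= x)%N -> Re (A k x) <= K.1.
  by case: (eqVneq k 1%g) => [_|/Re_Asum_le[K hK]]; [exists (0, 0%N)|exists K].
pose c := \sum_(k | (k != 1%g) && (k != i) && (k != j)) (K k).1.
pose x0 := \max_k (K k).2.
have [x [x_gt0 x0x lx]] := unbounded_from (2 * (3 / 2 * ell 2 + 2 * N%:R + c)) x0.
have key k : k != 1%g -> Re (A k x) <= (K k).1.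
  by move=> k1; apply: hK => //; apply: leq_trans x0x; apply: leq_bigmax.
have low k : k != 1%g -> vanishing (X k) N%:R -> Re (A k x) <= N%:R - ell x.
  move=> k1 vk; have := le_trans (Re_le_normc _) (Asum_vanishing ell (dchar_bounded XP k1) vk x_gt0).
  by case: (A k x) => a b /=; lra.
have pos : 0 <= \sum_k Re (A k x).
  have := Asum_orthogonal x (coprimen1 N).
  rewrite (eq_bigr (fun k => A k x)) => [eqS|k _]; last first.
    have X1 : X k 1%N = 1.
      have [->|k1] := eqVneq k 1%g; last by apply: chi1; apply: (dchar_bounded XP k1).
      by rewrite (dchar_principal XP) coprimen1.
    have -> : conjc (X k 1%N) = 1 by rewrite X1; apply: conjc1.
    by rewrite mul1r.
  rewrite -Re_sum eqS /= mulr_ge0 ?ler0n // sumr_ge0 // => n _.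
  exact: mangoldt_over_ge0.
move: pos; rewrite (bigD1 1%g) //= (bigD1 i) //= (bigD1 j) /=; last by rewrite j1.
have : \sum_(k | (k != 1%g) && (k != i) && (k != j)) Re (A k x) <= c.
  by apply: ler_sum => k /andP[/andP[k1 _] _]; apply: key.
have := principal_upper x_gt0; rewrite log_double // Asum_principal /=.
have := low i i1 van; have := low j j1 vanj.
lra.
Qed.

Lemma character_nonvanishing i : i != 1%g -> ~ vanishing (X i) N%:R.
Proof.
move=> i1; have [iV|iV] := eqVneq i^-1%g i.
  exact: self_conjugate_nonvanishing.
exact: complex_nonvanishing.
Qed.

(** Without primes in the class, its von Mangoldt sum would be at most 2, whereas the principal
    character contributes [log x] and all others a bounded amount. *)
Lemma prime_congruent_exists a : coprime N a -> exists2 p, prime p & p = a %[mod N].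
Proof.
move=> cNa; apply: NNPP => noprime.
have nprime n : n == a %[mod N] -> ~~ prime n.
  by move/eqP => na; apply/negP => n_pr; apply: noprime; exists n.
have /fin_all_exists[K hK] k : exists K : R * nat, k != 1%g ->
    forall x, (0 < x)%N -> (K.2 <= x)%N -> normc (A k x) <= K.1.
  case: (eqVneq k 1%g) => [_|k1]; first by exists (0, 0%N).
  have [x0 /negP h] := not_all_ex_not _ _ (character_nonvanishing k1).
  have [K hK] := Asum_nonvanishing ell (dchar_bounded XP k1) h.
  by exists (K, x0).
pose c := \sum_(k | k != 1%g) (K k).1.
pose d := 3 + \sum_(1 <= n < N.+1) lam n.
have [x [x_gt0 x0x lx]] := unbounded_from (c + d + #|I|%:R * 2) (\max_k (K k).2).
have key k : k != 1%g -> normc (A k x) <= (K k).1.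
  by move=> k1; apply: hK => //; apply: leq_trans x0x; apply: leq_bigmax.
have := congr1 (fun z => Re z) (Asum_orthogonal x cNa); rewrite Re_sum /=.
have up : \sum_(1 <= n < x.+1 | n == a %[mod N]) lam n <= 2.
  apply: le_trans (sum_mangoldt_nonprime ell x).
  rewrite big_mkcond [X in _ <= X]big_mkcond /=; apply: ler_sum => n _.
  case: ifP => [/nprime -> //|_]; case: ifP => // _; exact: mangoldt_over_ge0.
have := ler_wpM2l (ler0n R #|I|) up; set S := _ * \sum_(_ <= _ < _ | _) _ => hS eqS.
have : \sum_k Re (conjc (X k a) * A k x) >= ell x - d - c.
  rewrite (bigD1 1%g) //=; apply: lerD.
    rewrite (dchar_principal XP) cNa conjc1 mul1r Asum_principal /=.
    exact: principal_lower.
  rewrite -sumrN; apply: ler_sum => k k1.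
  rewrite lerNl; apply: le_trans (key k k1).
  have -> : normc (A k x) = normc (- (conjc (X k a) * A k x)).
    by rewrite normcN normcM normcJ (dchar_coprime XP) // mul1r.
  by apply: le_trans (Re_le_normc _); case: (_ * _).
by rewrite eqS; lra.
Qed.

End Dirichlet.

(** * The natural logarithm on the real numbers *)

Section RealLogarithm.
Local Notation R := Rdefinitions.R.
Local Notation ln := Rpower.ln.
Local Notation exp := Rtrigo_def.exp.
Local Arguments Rpower.ln x%_ring_scope.
Local Arguments Rtrigo_def.exp x%_ring_scope.

Lemma ln_mulr (x y : R) : 0 < x -> 0 < y -> ln (x * y) = ln x + ln y.
Proof. by move=> /RltP x0 /RltP y0; apply: Rpower.ln_mult. Qed.

Lemma ln_le_sub1 (x : R) : 0 < x -> ln x <= x - 1.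
Proof.
move=> /RltP x0; have /RleP := Rpower.exp_ineq1_le (ln x).
by rewrite Rpower.exp_ln // -[Rdefinitions.Rplus _ _]/(1 + ln x); lra.
Qed.

Definition real_log : logarithm R.
Proof.
exists (fun n => ln n%:R) => [m n m0 n0|m n /andP[n_gt0 nm]|K].
- by rewrite natrM ln_mulr // ltr0n.
- have n0 : (0 : R) < n%:R by rewrite ltr0n.
  have m0 : (0 : R) < m%:R by rewrite ltr0n (leq_trans n_gt0).
  have q0 : (0 : R) < m%:R / n%:R by rewrite divr_gt0.
  have q1 : (0 : R) < n%:R / m%:R by rewrite divr_gt0.
  have Dm : ln m%:R = ln n%:R + ln (m%:R / n%:R).
    by have := ln_mulr n0 q0; rewrite mulrC divfK // gt_eqF.
  have Dn : ln n%:R = ln m%:R + ln (n%:R / m%:R).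
    by have := ln_mulr m0 q1; rewrite mulrC divfK // gt_eqF.
  (* The bound at [m / n] gives the upper estimate, and the one at [n / m] gives monotonicity. *)
  have h1 := ln_le_sub1 q0; have h2 := ln_le_sub1 q1.
  have h3 : n%:R / m%:R <= 1 :> R by rewrite ler_pdivrMr // mul1r ler_nat.
  rewrite mulrBl divff ?gt_eqF //; apply/andP; split; lra.
- have e0 : 0 < exp K by apply/RltP; apply: Exp_prop.exp_pos.
  have h := archi_boundP (ltW e0).
  exists (Num.bound (exp K)); first by rewrite -(ltr_nat R); apply: lt_trans h.
  rewrite -{1}(Rpower.ln_exp K); apply/RltP; apply: Rpower.ln_increasing; first exact: Exp_prop.exp_pos.
  exact/RltP.
Defined.

End RealLogarithm.

Theorem dirichlet (N a : nat) : (1 < N)%N -> coprime N a ->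
  exists2 p, prime p & p = a %[mod N].
Proof.
move=> N_gt1 cNa.
have [I [X XP]] := dirichlet_characters_exist Rdefinitions.R N_gt1.
exact: (prime_congruent_exists real_log N_gt1 XP cNa).
Qed.

Local Close Scope complex_scope.
Local Close Scope ring_scope.

(** * Coincidences of primes modulo powers of b *)

Lemma sum_min M v : \sum_(1 <= l < M.+1) (l <= v : nat) = minn M v.
Proof.
elim: M => [|M IH]; first by rewrite big_nil min0n.
by rewrite big_nat_recr //= IH; lia.
Qed.

Definition ord_nat (b n : nat) : nat := \max_(k < n.+1 | b ^ k %| n) k.

Lemma ord_natP b n l : 1 < b -> 0 < n -> (b ^ l %| n) = (l <= ord_nat b n).
Proof.
move=> b_gt1 n_gt0; apply/idP/idP => [dv|].
  have ln : l < n.+1 by rewrite ltnW // ltnS (leq_trans (ltn_expl l b_gt1)) // dvdn_leq.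
  exact: (leq_bigmax_cond (Ordinal ln)).
have [k kP ->] : {k : 'I_n.+1 | b ^ k %| n & ord_nat b n = k}.
  by apply: eq_bigmax_cond; apply/card_gt0P; exists ord0; apply: dvd1n.
by move=> lk; apply: dvdn_trans kP; apply: dvdn_exp2l.
Qed.

(** The levels [l] with [b ^ l] dividing [n] form an initial segment, even for composite [b], so the
    order is a count of levels. *)
Lemma ord_nat_levels b n M : 1 < b -> 0 < n ->
  \sum_(1 <= l < M.+1) (b ^ l %| n : nat) = minn M (ord_nat b n).
Proof.
move=> b_gt1 n_gt0; rewrite -sum_min; apply: eq_bigr => l _.
by rewrite ord_natP.
Qed.

Lemma dvdn_absz_sub (d p q : nat) : (d %| absz (Posz p - Posz q)%R) = (p == q %[mod d]).
Proof.
case/orP: (leq_total q p) => h.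
  by rewrite distnEl // eqn_mod_dvd.
by rewrite distnEr // eq_sym eqn_mod_dvd.
Qed.

Lemma ordb_nat b (p q : nat) : p != q ->
  ordb b (Posz p - Posz q)%R = Some (ord_nat b (absz (Posz p - Posz q)%R)).
Proof.
move=> pq; rewrite /ordb ifN //.
by rewrite subr_eq0; apply: contra pq => /eqP[->].
Qed.

Lemma absz_sub_gt0 (p q : nat) : p != q -> 0 < absz (Posz p - Posz q)%R.
Proof. by rewrite absz_gt0 subr_eq0; apply: contra => /eqP[->]. Qed.

Definition ord_sum (b : nat) (q : nat -> nat) (p i : nat) : nat :=
  \sum_(0 <= j < i) ord_nat b (absz (Posz p - Posz (q j))%R).

Lemma psum_nat b (a : nat -> int) (q : nat -> nat) p i :
  (forall j, j < i -> a j = Posz (q j)) -> (forall j, j < i -> p != q j) ->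
  psum b a (Posz p) i = Some (ord_sum b q p i).
Proof.
move=> aq pq; rewrite /psum /ord_sum /index_iota subn0.
have : forall j, j \in iota 0 i -> j < i by move=> j; rewrite mem_iota.
elim: (iota 0 i) => [|j s IH] js /=; first by rewrite big_nil.
rewrite IH => [|x xs]; last by apply: js; rewrite inE xs orbT.
have ji : j < i by apply: js; rewrite inE eqxx.
by rewrite aq // ordb_nat ?pq // big_cons.
Qed.

Lemma psum_repeat b (a : nat -> int) x i j : j < i -> a j = x -> psum b a x i = None.
Proof.
move=> ji ax; rewrite /psum; have : j \in iota 0 i by rewrite mem_iota.
elim: (iota 0 i) => [//|m s IH] /=; rewrite inE => /orP[/eqP <-|/IH ->].
  by rewrite ax subrr /ordb eqxx.
by case: (ordb _ _).
Qed.

Lemma pigeonhole_le (T : eqType) (s : seq T) (f : T -> nat) n :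
  0 < size s -> \sum_(x <- s) f x <= n -> exists2 x, x \in s & f x <= n %/ size s.
Proof.
move=> s0 fn; have [/hasP[x xs fx]|/hasPn h] := boolP (has (fun x => f x <= n %/ size s) s).
  by exists x.
have : \sum_(x <- s) (n %/ size s).+1 <= \sum_(x <- s) f x.
  by rewrite big_seq [X in _ <= X]big_seq; apply: leq_sum => x /h; rewrite -ltnNge.
rewrite big_const_seq count_predT iter_addn_0 => h1.
by have := ltn_ceil n s0; lia.
Qed.

Definition class_count (q : nat -> nat) (k m c : nat) : nat := \sum_(0 <= j < k) (q j == c %[mod m] : nat).

Definition units (b : nat) : seq nat := [seq c <- iota 0 b | coprime b c].

Lemma size_units b : 0 < b -> size (units b) = totient b.
Proof.
move=> b0; rewrite totient_count_coprime size_filter -sum1_count.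
rewrite big_mkcond /= -/(index_iota 0 b); rewrite /index_iota subn0.
by apply: eq_bigr => i _; case: coprime.
Qed.

Lemma sum_eq_mem (s : seq nat) x : uniq s -> x \in s -> \sum_(c <- s) (x == c : nat) = 1.
Proof.
move=> us xs; rewrite (bigD1_seq x) //= eqxx big1 ?addn0 // => i ix.
by rewrite eq_sym (negbTE ix).
Qed.

Lemma sum_le_has (T : eqType) (s : seq T) (P : pred T) : uniq s ->
  {in s &, forall x y, P x -> P y -> x = y} -> \sum_(x <- s) (P x : nat) <= has P s.
Proof.
move=> us inj; have [/hasP[x xs Px]|/hasPn h] := boolP (has P s).
  rewrite (bigD1_seq x) //= Px big1_seq // => y /andP[yx ys].
  by apply/eqP; rewrite eqb0; apply: contra yx => Py; rewrite (inj y x).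
by rewrite big1_seq // => x /andP[_ /h]; case: (P x).
Qed.

Definition unit_count (b : nat) (q : nat -> nat) (k : nat) : nat :=
  \sum_(0 <= j < k) (coprime b (q j) : nat).

Lemma sum_units_class b x : 0 < b ->
  \sum_(c <- units b) (x == c %[mod b] : nat) = coprime b x.
Proof.
move=> b0; have us : uniq (units b) by rewrite filter_uniq // iota_uniq.
rewrite (eq_big_seq (fun c => x %% b == c : nat)) => [|c]; last first.
  by rewrite mem_filter mem_iota /= add0n => /andP[_ cb]; rewrite (modn_small cb).
have [cop|ncop] := boolP (coprime b x).
  by apply: sum_eq_mem => //; rewrite mem_filter mem_iota /= add0n ltn_pmod // coprime_modr cop.
rewrite big1_seq // => c /andP[_]; rewrite mem_filter => /andP[cc _].
apply/eqP; rewrite eqb0; apply: contra ncop => /eqP xc.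
by rewrite -coprime_modr xc.
Qed.

Lemma light_unit_class b q k : 1 < b ->
  exists2 c, coprime b c & class_count q k b c <= unit_count b q k %/ totient b.
Proof.
move=> b1; have b0 := ltnW b1.
have [||c cu hc] := @pigeonhole_le _ (units b) (class_count q k b) (unit_count b q k).
- by rewrite size_units // totient_gt0.
- rewrite /class_count exchange_big /= /unit_count.
  by apply: leq_sum => j _; rewrite sum_units_class.
exists c; last by rewrite -size_units.
by move: cu; rewrite mem_filter => /andP[].
Qed.

(** A class modulo [M] splits into [b] disjoint classes modulo [b * M]; the lightest is at most the
    average. *)
Lemma light_subclass b q k M c : 0 < b -> 0 < M ->
  exists t, class_count q k (b * M) (c + t * M) <= class_count q k M c %/ b.
Proof.
move=> b0 M0.
have [||t _ ht] := @pigeonhole_le _ (iota 0 b) (fun t => class_count q k (b * M) (c + t * M)) (class_count q k M c).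
- by rewrite size_iota.
- rewrite /class_count exchange_big /=; apply: leq_sum => j _.
  apply: leq_trans (sum_le_has _ _) _; first exact: iota_uniq.
    move=> t u; rewrite !mem_iota /= !add0n => tb ub /eqP -> .
    rewrite eqn_modDl -!muln_modl !(modn_small tb) !(modn_small ub) eqn_pmul2r //.
    by move/eqP.
  case: hasP => // -[t _ /eqP h]; rewrite lt0b; apply/eqP.
  have d : M %| b * M by apply: dvdn_mull.
  by rewrite -(modn_dvdm (q j) d) h (modn_dvdm _ d) addnC modnMDl.
by exists t; move: ht; rewrite size_iota.
Qed.

Lemma class_count_congr q k m c c' : c = c' %[mod m] -> class_count q k m c = class_count q k m c'.
Proof. by move=> h; apply: eq_bigr => j _; rewrite h. Qed.

(* Refining the lightest class level by level keeps every level below its average. *)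
Lemma light_class_tower b q k L : 1 < b ->
  exists2 c, coprime b c &
    forall l, l <= L -> class_count q k (b ^ l.+1) c <= unit_count b q k %/ (b ^ l * totient b).
Proof.
move=> b1; have b0 := ltnW b1.
elim: L => [|L [c cc hc]].
  have [c cc hc] := light_unit_class q k b1; exists c => // l.
  by rewrite leqn0 => /eqP ->; rewrite expn1 expn0 mul1n.
have M0 : 0 < b ^ L.+1 by rewrite expn_gt0 b0.
have [t ht] := light_subclass q k c b0 M0.
have cE l : l <= L -> c + t * b ^ L.+1 = c %[mod b ^ l.+1].
  move=> lL; have d : b ^ l.+1 %| b ^ L.+1 by rewrite dvdn_exp2l.
  by rewrite -modnDmr -modnMmr (eqP d) muln0 mod0n addn0.
exists (c + t * b ^ L.+1).
  by rewrite -coprime_modr -[b in _ %% b]expn1 (cE 0) // expn1 coprime_modr.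
move=> l; rewrite leq_eqVlt => /orP[/eqP ->|]; last first.
  by rewrite ltnS => lL; rewrite (class_count_congr _ _ (cE l lL)) hc.
rewrite expnS; apply: leq_trans ht _.
have -> : b ^ L.+1 * totient b = (b ^ L * totient b) * b by rewrite expnS; lia.
(* Iterated floor divisions compose exactly, so nothing is lost from level to level. *)
by rewrite divnMA leq_div2r // hc.
Qed.

Lemma unit_count_complement b q k : unit_count b q k + \sum_(0 <= j < k) (~~ coprime b (q j) : nat) = k.
Proof.
rewrite /unit_count -big_split /= (eq_bigr (fun=> 1)) => [|j _]; last by case: coprime.
by rewrite sum_nat_const_nat subn0 muln1.
Qed.

Lemma nonunits_size b q k :
  \sum_(0 <= j < k) (~~ coprime b (q j) : nat) = size [seq j <- iota 0 k | ~~ coprime b (q j)].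
Proof.
rewrite size_filter -sum1_count [in RHS]big_mkcond /index_iota subn0 /=.
by apply: eq_bigr => j _; case: coprime.
Qed.

(** The prime divisors of [b] all occur, at pairwise distinct nonunit indices. *)
Lemma unit_count_le b q k : 0 < b ->
  {subset primes b <= [seq q j | j <- iota 0 k]} -> unit_count b q k + omega b <= k.
Proof.
move=> b0 sub; rewrite -{2}(unit_count_complement b q k) leq_add2l nonunits_size.
rewrite -(size_map q); apply: uniq_leq_size; first exact: primes_uniq.
move=> p pb; have /mapP[j jk pj] := sub p pb.
apply/mapP; exists j => //; rewrite mem_filter jk andbT -pj coprime_sym.
move: pb; rewrite mem_primes => /and3P[p_pr _ pb].
by rewrite prime_coprime // pb.
Qed.

(** A prime that is not a unit modulo [b] divides [b], and no value is repeated. *)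
Lemma unit_count_ge b q k : 0 < b -> (forall j, j < k -> prime (q j)) ->
  (forall i j, i < k -> j < k -> q i = q j -> i = j) -> k <= unit_count b q k + omega b.
Proof.
move=> b0 q_pr q_inj; rewrite -{1}(unit_count_complement b q k) leq_add2l nonunits_size.
rewrite -(size_map q); apply: uniq_leq_size.
  rewrite map_inj_in_uniq ?filter_uniq ?iota_uniq // => i j.
  rewrite !mem_filter !mem_iota /= !add0n => /andP[_ ik] /andP[_ jk].
  exact: q_inj.
move=> p /mapP[j]; rewrite mem_filter mem_iota /= add0n => /andP[ncop jk] ->.
rewrite mem_primes q_pr // b0 /=; move: ncop.
by rewrite coprime_sym prime_coprime ?q_pr // negbK.
Qed.

Lemma ord_sum_levels b q p k M : 1 < b -> (forall j, j < k -> p != q j) ->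
  \sum_(0 <= j < k) minn M (ord_nat b (absz (Posz p - Posz (q j))%R))
  = \sum_(1 <= l < M.+1) class_count q k (b ^ l) p.
Proof.
move=> b1 pq; rewrite /class_count exchange_big /=; apply: eq_big_nat => j /andP[_ jk].
rewrite -ord_nat_levels ?absz_sub_gt0 ?pq //; apply: eq_bigr => l _.
by rewrite dvdn_absz_sub eq_sym.
Qed.

Lemma light_prime b q k : 1 < b -> (forall j, j < k -> prime (q j)) ->
  exists p, [/\ prime p, forall j, j < k -> p != q j & ord_sum b q p k <= rhs b k].
Proof.
move=> b1 q_pr; have b0 := ltnW b1.
have [/allP sub|] := boolP (all (mem [seq q j | j <- iota 0 k]) (primes b)); last first.
  case/allPn => p; rewrite mem_primes => /and3P[p_pr _ pb] pN.
  have pq j : j < k -> p != q j.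
    by move=> jk; apply: contra pN => /eqP ->; apply: map_f; rewrite mem_iota.
  (* A point congruent to [p] modulo [b] would be a prime divisible by [p], hence equal to [p]; so
     every order is 0. *)
  exists p; split => //; rewrite /ord_sum big1_seq // => j /andP[_].
  rewrite mem_index_iota => /andP[_ jk].
  apply/eqP; rewrite -leqn0 leqNgt -ord_natP ?absz_sub_gt0 ?pq // expn1 dvdn_absz_sub.
  apply/negP => /eqP pqb; move/negP: (pq j jk); apply; rewrite -dvdn_prime2 ?q_pr //.
  by rewrite /dvdn -(modn_dvdm (q j) pb) -pqb (modn_dvdm _ pb) modnn.
have mk := unit_count_le b0 sub.
have [c cc hc] := light_class_tower q k k b1.
have [p p_pr pc] : exists2 p, prime p & p = c %[mod b ^ k.+1].
  apply: dirichlet; last by rewrite coprimeXl.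
  by rewrite -(exp1n k.+1) ltn_exp2r.
have pcl l : l <= k -> class_count q k (b ^ l.+1) p <= unit_count b q k %/ (b ^ l * totient b).
  move=> lk; rewrite (class_count_congr _ _ (_ : p = c %[mod b ^ l.+1])) ?hc //.
  have d : b ^ l.+1 %| b ^ k.+1 by rewrite dvdn_exp2l.
  by rewrite -(modn_dvdm p d) pc modn_dvdm.
(* As [b ^ k * totient b > k], the top level is empty: the prime is automatically new and all its
   orders are at most [k], so the level counts give them in full. *)
have top : class_count q k (b ^ k.+1) p = 0.
  apply/eqP; rewrite -leqn0; apply: leq_trans (pcl k (leqnn k)) _.
  rewrite leqn0 divn_small //.
  have := ltn_expl k b1; have : 0 < totient b by rewrite totient_gt0.
  nia.
have nc j : j < k -> q j != p %[mod b ^ k.+1].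
  move=> jk; move/eqP: top; rewrite /class_count sum_nat_seq_eq0 => /allP/(_ j).
  by rewrite mem_index_iota jk eqb0; apply.
have pq j : j < k -> p != q j by move=> /nc; apply: contra => /eqP ->.
exists p; split => //.
rewrite /rhs (leq_trans _ mk) ?leq_addl //.
have -> : ord_sum b q p k = \sum_(1 <= l < k.+2) class_count q k (b ^ l) p.
  rewrite -ord_sum_levels //; apply: eq_big_nat => j /andP[_ jk].
  apply/esym/minn_idPr; rewrite leqNgt; apply: contra (nc j jk) => h.
  rewrite eq_sym -dvdn_absz_sub ord_natP ?absz_sub_gt0 ?pq //; exact: ltnW.
rewrite big_add1 /= big_mkord; apply: leq_sum => l _.
apply: leq_trans (pcl l (ltn_ord l : l <= k)) _.
by apply: leq_div2r; lia.
Qed.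

(** * Convexity and the lower bound for partial sums *)

Lemma leq_sum_range m n (F G : nat -> nat) :
  (forall i, m <= i < n -> F i <= G i) ->
  \sum_(m <= i < n) F i <= \sum_(m <= i < n) G i.
Proof.
by move=> FG; rewrite big_nat [X in _ <= X]big_nat; apply: leq_sum => i /FG.
Qed.

(** With [u = m %/ C] the sum is [u * m - C * u * (u + 1) / 2], here cleared of subtraction and
    division. *)
Lemma sum_divn C m : 0 < C ->
  2 * (\sum_(0 <= i < m) i %/ C) + C * (m %/ C * (m %/ C).+1) = 2 * (m %/ C) * m.
Proof.
move=> C0; elim: m => [|m IH]; first by rewrite big_geq // div0n; lia.
rewrite big_nat_recr //= divnS //; case: (boolP (C %| m.+1)) => [/dvdnP[r mr]|_] /=; last first.
  by rewrite add0n; move: IH; move: (m %/ C) (\sum_(0 <= i < m) _) => u v; lia.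
have r0 : 0 < r by case: r mr.
have -> : m %/ C = r.-1.
  have := divnS m C0; rewrite mr mulnK // dvdn_mull //=; lia.
move: IH; have -> : m %/ C = r.-1.
  have := divnS m C0; rewrite mr mulnK // dvdn_mull //=; lia.
case: r r0 mr => // r _ mr /=; move: (\sum_(0 <= i < m) _) => v; nia.
Qed.

(** This is [(n - q) * (n - q - 1) >= 0] over the integers, with equality at the two occupancies [q]
    and [q + 1] of a balanced configuration. *)
Lemma tangent_square n q : (2 * q).+1 * n <= n * n + q * q.+1.
Proof.
have [nq|qn] := leqP n q.
  by rewrite -(subnKC nq); move: (q - n) => t; nia.
by rewrite -(subnKC qn); move: (n - q.+1) => t; nia.
Qed.

(* Sum the tangent line of the square at the average. *)
Lemma balanced_coincidences (T : Type) (s : seq T) (f : T -> nat) m :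
  0 < size s -> \sum_(c <- s) f c = m ->
  m + 2 * (\sum_(0 <= i < m) i %/ size s) <= \sum_(c <- s) f c * f c.
Proof.
move=> s0 fm; set C := size s in s0 *; set q := m %/ C.
have : \sum_(c <- s) (2 * q).+1 * f c <= \sum_(c <- s) (f c * f c + q * q.+1).
  by apply: leq_sum => c _; apply: tangent_square.
rewrite -big_distrr /= fm big_split /= big_const_seq count_predT iter_addn_0 -/C.
have := sum_divn m s0; rewrite -/q; move: (\sum_(0 <= i < m) _) (\sum_(c <- s) _) => u v.
nia.
Qed.

Lemma symmetric_double_sum (e : nat -> nat -> nat) n :
  (forall i j, e i j = e j i) -> (forall i, e i i = 1) ->
  \sum_(0 <= i < n) \sum_(0 <= j < n) e i j
  = n + 2 * \sum_(0 <= i < n) \sum_(0 <= j < i) e i j.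
Proof.
move=> e_sym ediag; elim: n => [|n IH]; first by rewrite !big_geq.
rewrite !big_nat_recr //= ediag.
rewrite (eq_bigr (fun i => \sum_(0 <= j < n) e i j + e i n)) => [|i _]; last by rewrite big_nat_recr.
have En : \sum_(0 <= i < n) e i n = \sum_(0 <= j < n) e n j by apply: eq_bigr.
rewrite big_split /= IH En; lia.
Qed.

(** Representatives of the units modulo [b ^ l.+1]: coprimality to [b] depends only on the residue
    [c] modulo [b]. *)
Definition unit_classes (b l : nat) : seq nat :=
  [seq c + b * t | c <- units b, t <- iota 0 (b ^ l)].

Lemma size_unit_classes b l : 0 < b -> size (unit_classes b l) = b ^ l * totient b.
Proof. by move=> b0; rewrite size_allpairs size_iota size_units // mulnC. Qed.

Lemma uniq_unit_classes b l : 0 < b -> uniq (unit_classes b l).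
Proof.
move=> b0; apply: allpairs_uniq; rewrite ?filter_uniq ?iota_uniq //.
move=> [c t] [d u] /allpairsPdep[c1 [t1 [cu _ [-> ->]]]] /allpairsPdep[d1 [u1 [du _ [-> ->]]]] /=.
have lt x : x \in units b -> x < b by rewrite mem_filter mem_iota add0n => /and3P[].
move=> E; have tE : t1 = u1.
  have := congr1 (divn^~ b) E.
  by rewrite /= ![b * _]mulnC !divnDMl // !divn_small ?lt.
by move: E; rewrite tE => /addIn ->.
Qed.

Lemma mem_unit_classes b l x : 0 < b -> coprime b x -> x %% b ^ l.+1 \in unit_classes b l.
Proof.
move=> b0 cx; set y := x %% _.
have yx : y %% b = x %% b by rewrite /y modn_dvdm // expnS dvdn_mulr.
apply/allpairsPdep; exists (y %% b), (y %/ b); split.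
- by rewrite mem_filter mem_iota /= add0n ltn_pmod // yx coprime_modr cx.
- rewrite mem_iota /= add0n ltn_divLR // -expnSr ltn_pmod // expn_gt0 b0 //.
- by rewrite addnC mulnC -divn_eq.
Qed.

(** Ordered pairs of congruent units are counted by squares of class occupancies, to which convexity
    applies; at least [n - omega b] of the points are units. *)
Lemma level_coincidences b q n l : 0 < b -> (forall j, j < n -> prime (q j)) ->
  (forall i j, i < n -> j < n -> q i = q j -> i = j) ->
  \sum_(0 <= i < n - omega b) i %/ (b ^ l * totient b)
  <= \sum_(0 <= i < n) class_count q i (b ^ l.+1) (q i).
Proof.
move=> b0 q_pr q_inj; set M := b ^ l.+1.
have mn := unit_count_ge b0 q_pr q_inj; set m := unit_count b q n in mn.
have nm := unit_count_complement b q n; rewrite -/m in nm.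
pose U i : nat := coprime b (q i).
pose e i j : nat := q j == q i %[mod M].
pose g i c : nat := coprime b (q i) && (q i %% M == c).
have s0 : 0 < size (unit_classes b l).
  by rewrite size_unit_classes // muln_gt0 expn_gt0 b0 totient_gt0.
have gsum i : \sum_(c <- unit_classes b l) g i c = U i.
  rewrite /g /U; case: (boolP (coprime b (q i))) => /= cop; last by rewrite big1.
  by rewrite sum_eq_mem ?uniq_unit_classes ?mem_unit_classes.
have fm : \sum_(c <- unit_classes b l) \sum_(0 <= i < n) g i c = m.
  by rewrite exchange_big /=; apply: eq_bigr => i _; apply: gsum.
have := balanced_coincidences s0 fm; rewrite size_unit_classes //.
set C := b ^ l * totient b => low.
have up : \sum_(c <- unit_classes b l) (\sum_(0 <= i < n) g i c) * (\sum_(0 <= i < n) g i c)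
    <= \sum_(0 <= i < n) U i * \sum_(0 <= j < n) e i j.
  rewrite (eq_bigr (fun c => \sum_(0 <= i < n) \sum_(0 <= j < n) g i c * g j c)) => [|c _]; last first.
    by rewrite big_distrl; apply: eq_bigr => i _; rewrite big_distrr.
  rewrite exchange_big /=; apply: leq_sum => i _.
  rewrite exchange_big /= big_distrr /=; apply: leq_sum => j _.
  apply: (@leq_trans (\sum_(c <- unit_classes b l) g i c * e i j)); last first.
    by rewrite -big_distrl /= gsum.
  apply: leq_sum => c _; rewrite /g /e.
  case: (coprime b (q i)) => //=; case: (coprime b (q j)) => /=; last by rewrite muln0.
  by case: eqP => // ->; case: eqP => // ->; rewrite eqxx.
(* Each nonunit contributes at least its diagonal pair; with the [m] of the convexity bound this
   makes up the diagonal [n]. *)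
have split : \sum_(0 <= i < n) U i * (\sum_(0 <= j < n) e i j)
     + \sum_(0 <= j < n) (~~ coprime b (q j) : nat) <= \sum_(0 <= i < n) \sum_(0 <= j < n) e i j.
  rewrite -big_split /=; apply: leq_sum_range => i /andP[_ iltn] /=; rewrite /U.
  case: coprime; rewrite /= ?mul1n ?addn0 // mul0n add0n.
  rewrite (bigD1_seq i) ?mem_index_iota ?iota_uniq //=.
  by rewrite /e eqxx.
rewrite symmetric_double_sum in split; try by move=> *; rewrite /e ?eqxx // eq_sym.
have -> : \sum_(0 <= i < n) class_count q i M (q i) = \sum_(0 <= i < n) \sum_(0 <= j < i) e i j by [].
apply: (@leq_trans (\sum_(0 <= i < m) i %/ C)).
  rewrite [X in _ <= X](@big_cat_nat _ _ _ (n - omega b)) //= ?leq_addr //.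
  by rewrite leq_subLR addnC.
lia.
Qed.

Lemma sum_shift (F : nat -> nat) w n :
  \sum_(0 <= i < n) (if w <= i then F (i - w) else 0) = \sum_(0 <= i < n - w) F i.
Proof.
elim: n => [|n IH]; first by rewrite !big_geq.
rewrite big_nat_recr //= IH; case: leqP => wn; last by rewrite addn0 !big_geq //; lia.
by rewrite subSn // big_nat_recr.
Qed.

(** Both sides are brought to [n] common levels before the sums are exchanged: truncation lowers the
    orders, and extra levels only raise the formula. *)
Lemma sum_rhs_le b q n : 1 < b -> (forall j, j < n -> prime (q j)) ->
  (forall i j, i < n -> j < n -> q i = q j -> i = j) ->
  \sum_(0 <= i < n) rhs b i <= \sum_(0 <= i < n) ord_sum b q (q i) i.
Proof.
move=> b1 q_pr q_inj; have b0 := ltnW b1.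
apply: (@leq_trans (\sum_(0 <= i < n) \sum_(1 <= l < n.+1) class_count q i (b ^ l) (q i))); last first.
  apply: leq_sum_range => i /andP[_ iltn]; rewrite -ord_sum_levels //.
    by apply: leq_sum => j _; apply: geq_minr.
  move=> j ji; apply/eqP => qq; have := q_inj i j iltn (ltn_trans ji iltn) qq; lia.
apply: (@leq_trans (\sum_(0 <= i < n) \sum_(0 <= l < n)
    (if omega b <= i then (i - omega b) %/ (b ^ l * totient b) else 0))).
  apply: leq_sum_range => i /andP[_ iltn]; rewrite /rhs; case: ifP => // _.
  rewrite -(big_mkord xpredT (fun l => (i - omega b) %/ (b ^ l * totient b))).
  by rewrite [X in _ <= X](@big_cat_nat _ _ _ i.+1) //= leq_addr.
rewrite exchange_big [X in _ <= X]exchange_big /= big_add1 /=.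
apply: leq_sum => l _.
rewrite (sum_shift (fun i => i %/ (b ^ l * totient b))).
exact: level_coincidences.
Qed.

(** * Existence of b-orderings and the exponent sequence *)

Definition psum_seq (b : nat) (s : seq int) (x : int) : enat :=
  foldr (fun y acc => eadd (ordb b (x - y)%R) acc) (Some 0) s.

Lemma psum_seqE b a x i : psum b a x i = psum_seq b [seq a j | j <- iota 0 i] x.
Proof. by rewrite /psum /psum_seq foldr_map. Qed.

(** Well-foundedness of the naturals if some value is finite; otherwise every point is minimal. *)
Lemma enat_minimum (T : Type) (S : T -> Prop) (f : T -> enat) :
  (exists x, S x) -> exists2 x, S x & forall y, S y -> ele (f x) (f y).
Proof.
case=> x0 Sx0; have [[x [Sx [n fx]]]|none] := classic (exists x, S x /\ exists n, f x = Some n).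
  move: x Sx fx; elim/ltn_ind: n => n IH x Sx fx.
  have [[y [Sy [m [fy mn]]]]|h] := classic (exists y, S y /\ exists m, f y = Some m /\ m < n).
    exact: IH mn y Sy fy.
  exists x => // y Sy; rewrite fx; case fy: (f y) => [m|] //=.
  by rewrite leqNgt; apply/negP => mn; apply: h; exists y; split => //; exists m.
exists x0 => // y Sy; case fy: (f y) => [m|]; last by case: (f x0).
by case: none; exists y; split => //; exists m.
Qed.

(** Greedy choice, by recursion on the list of earlier values. *)
Lemma b_ordering_exists (b : nat) : exists a, is_b_ordering primesZ b a.
Proof.
have next s : {x : int | primesZ x /\ forall y, primesZ y -> ele (psum_seq b s x) (psum_seq b s y)}.
  apply: constructive_indefinite_description.
  have [|x Px xmin] := @enat_minimum int primesZ (psum_seq b s); first by exists (Posz 2).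
  by exists x.
pose L := fix L n := if n is m.+1 then rcons (L m) (sval (next (L m))) else [::].
pose a n := sval (next (L n)).
have LE n : [seq a j | j <- iota 0 n] = L n.
  by elim: n => // n IH; rewrite -addn1 iotaD map_cat IH cats1 addn1.
exists a; split => [i|i _ y Sy]; first by case: (svalP (next (L i))).
by rewrite !psum_seqE LE; case: (svalP (next (L i))) => _; apply.
Qed.

(** Minimality compares each term with the prime of [light_prime]. The resulting finite bound rules
    out repetitions, since a repeated value costs [+oo]. *)
Lemma b_ordering_bound (b : nat) (a : nat -> int) : 1 < b -> is_b_ordering primesZ b a ->
  let q i := absz (a i) in
  [/\ forall i, prime (q i), forall i j, j < i -> q i != q j,
      forall i, psum b a (a i) i = Some (ord_sum b q (q i) i)
    & forall i, ord_sum b q (q i) i <= rhs b i].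
Proof.
move=> b1 [aP amin] q.
have aq i : a i = Posz (q i).
  by have /andP[a0 _] := aP i; rewrite /q gez0_abs // ltW.
have q_pr i : prime (q i) by case/andP: (aP i).
have bound i : exists2 n, psum b a (a i) i = Some n & n <= rhs b i.
  have [p [p_pr pq pr]] := light_prime (k := i) b1 (fun j _ => q_pr j).
  (* Minimality is assumed only from index 1 on; at index 0 the sum is empty. *)
  case: i p_pr pq pr => [|i] p_pr pq pr; first by exists 0.
  have Sp : primesZ (Posz p) by rewrite /primesZ /= p_pr ltz_nat prime_gt0.
  have := amin i.+1 isT _ Sp; rewrite (psum_nat b (fun j _ => aq j) pq).
  case: (psum b a (a i.+1) i.+1) => // n h; exists n => //.
  exact: leq_trans h pr.
have dist i j : j < i -> q i != q j.
  move=> ji; apply/eqP => qq; have [n] := bound i.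
  by rewrite (psum_repeat b ji) // aq -qq -aq.
have psumE i : psum b a (a i) i = Some (ord_sum b q (q i) i).
  by rewrite aq; apply: psum_nat => // j; apply: dist.
by split=> // i; have [n] := bound i; rewrite psumE => -[->].
Qed.

Lemma rhs_eq0 b k : 1 < b -> k < totient b + omega b -> rhs b k = 0.
Proof.
move=> b1 kb; rewrite /rhs; case: ifP => // wk; apply: big1 => i _.
apply: divn_small; apply: (@leq_trans (totient b)); first by rewrite ltn_subLR // addnC.
by rewrite leq_pmull // expn_gt0 ltnW.
Qed.

Theorem theorem8p1 (b k : nat) : 2 <= b ->
  (exists a : nat -> int, is_b_ordering primesZ b a) /\
  (forall a : nat -> int, is_b_ordering primesZ b a ->
     alpha_of b a k = Some (rhs b k) /\
     (k < totient b + omega b -> alpha_of b a k = Some 0)).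
Proof.
move=> b1; split; first exact: b_ordering_exists.
move=> a aP; have [q_pr dist psumE bound] := b_ordering_bound b1 aP.
suff -> : alpha_of b a k = Some (rhs b k).
  by split=> // kb; rewrite rhs_eq0.
rewrite /alpha_of psumE; congr Some; apply/eqP; rewrite eqn_leq bound /=.
have inj i j : i < k.+1 -> j < k.+1 -> absz (a i) = absz (a j) -> i = j.
  by move=> _ _ E; case: (ltngtP i j) => // /dist; rewrite E eqxx.
(* The sums up to [k] satisfy one inequality and each term the reverse one, so the last terms
   agree. *)
have := sum_rhs_le b1 (fun j _ => q_pr j) inj; rewrite !big_nat_recr //= => h.
have : \sum_(0 <= i < k) ord_sum b (fun i => absz (a i)) (absz (a i)) i
   <= \sum_(0 <= i < k) rhs b i by apply: leq_sum => i _; apply: bound.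
lia.
Qed.
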